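(* Let $\rho_1,\rho_2,r_1,r_2$ be real numbers with $$r_1+r_2,\quad \rho_1+\rho_2,\quad r_1+r_2+\rho_1+\rho_2,\quad r_1+r_2-\rho_1-\rho_2\ \notin\ \mathbb Z,$$ $$\frac{r_1-r_2-\rho_1+\rho_2+1}{2},\quad \frac{r_1-r_2+\rho_1-\rho_2+1}{2},\quad r_i-\rho_j+\frac12,\quad r_i+\rho_j+\frac12\ \notin\ \mathbb Z\qquad(i,j\in\{1,2\}).$$ Let $\mathbf d=(d,m)$ with $d\in\{1,\ldots,8\}$, $m\in\mathbb Z_{\ge0}$, $\mathbf d\ne(1,0),(4,0)$, and let $X$ be the collection (listed in the order $n=0,1,2,\ldots$, with repetitions) of the degrees of the polynomials $B^{(1)}_{\mathbf d,n}(x)$, $n\in\mathbb Z_{\ge0}$, where in the case $d=1$ the value $n=m$ is omitted. Then: If $m$ is odd: - $d=1$: $X=\{m-1,m,m+1,\ldots,2m-2,2m,2m+1,\ldots\}$; - $d=4$: $X=\{m-1,m,m+1,m+2,m+3,\ldots\}$; - $d=2,3$: $X=\{m+1,m+2,m+3,m+4,m+5,\ldots\}$; - $d=5,6,7,8$: $X=\{m-1,m+1,m+1,m+3,m+3,\ldots\}$. If $m$ is even: - $d=1$: $X=\{m-2,m,m,\ldots,2m-4,2m-4,2m-2,2m,2m,\ldots\}$ (i.e. $n=0$ gives $m-2$, each pair $(n,n+1)$ with $n$ odd gives $n+m-1$ twice, except that the term for $n=m$ is omitted so $2m-2$ occurs only once); - $d=4$: $X=\{m-2,m,m,m+2,m+2,\ldots\}$;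 - $d=2,3$: $X=\{m,m+2,m+2,m+4,m+4,\ldots\}$; - $d=5,6,7,8$: $X=\{m,m+1,m+2,m+3,m+4,\ldots\}$.
   Context: Operators act by $R[f(x)]=f(-x)$, $T[f(x)]=f(x+1)$, $I[f(x)]=f(x)$, so $TR[f(x)]=f(-x-1)$; a function next to an operator denotes multiplication. The Bannai-Ito operator is $H=\alpha(x)(R-I)+\beta(x)(TR-I)$ with $\alpha(x)=\frac{(x-\rho_1)(x-\rho_2)}{-2x}$, $\beta(x)=\frac{(x-r_1+1/2)(x-r_2+1/2)}{2x+1}$. $B_n(x)=B_n(x;\rho_1,\rho_2,r_1,r_2)$ is the monic polynomial of degree $n$ with $H[B_n]=\lambda_nB_n$, $\lambda_n=n/2$ ($n$ even), $\lambda_n=r_1+r_2-\rho_1-\rho_2-\frac{n+1}2$ ($n$ odd). For a list $\sigma$, $B_n(x;\sigma)$ is the same polynomial with the parameters $(\rho_1,\rho_2,r_1,r_2)$ replaced by $\sigma$. Let $\sigma_1=\{\rho_1,\rho_2,r_1,r_2\}$, $\sigma_2=\{-\rho_1,-\rho_2,-r_1,-r_2\}$, $\sigma_3=\{-\rho_1,-\rho_2,r_1,r_2\}$, $\sigma_4=\{\rho_1,\rho_2,-r_1,-r_2\}$, $\sigma_5=\{-\rho_1,\rho_2,-r_1,r_2\}$, $\sigma_6=\{\rho_1,-\rho_2,r_1,-r_2\}$, $\sigma_7=\{\rho_1,-\rho_2,-r_1,r_2\}$, $\sigma_8=\{-\rho_1,\rho_2,r_1,-r_2\}$. With $g_i(x)=\Gamma(\frac12+r_i+x)\Gamma(\frac12+r_i-x)$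 and $q_j(x)=\Gamma(\rho_j-x)\Gamma(1+\rho_j+x)$ put $$\xi_1=1,\ \xi_2=\frac{g_1g_2}{q_1q_2},\ \xi_3=\frac1{q_1q_2},\ \xi_4=g_1g_2,\ \xi_5=\frac{g_1}{q_1},\ \xi_6=\frac{g_2}{q_2},\ \xi_7=\frac{g_1}{q_2},\ \xi_8=\frac{g_2}{q_1}.$$ For $\mathbf d=(d,m)$ let $p^{(d)}_m(x)=B_m(x;\sigma_d)$ and $\phi_{\mathbf d}(x)=\xi_d(x)p^{(d)}_m(x)$; this is an eigenfunction of $H$ (assumed, throughout, uniquely determined by $\mathbf d$ up to a constant multiplier). Put $$\eta_1=\eta_4=1,\quad \eta_2=\eta_3=(x-\rho_1)(x-\rho_2),\quad \eta_5=\eta_8=x-\rho_1,\quad \eta_6=\eta_7=x-\rho_2,$$ $$\chi(x)=\phi_{\mathbf d}(x)-\phi_{\mathbf d}(-x),\quad \tilde\chi(x)=\beta(-x-1)\phi_{\mathbf d}(x)+\beta(x)\phi_{\mathbf d}(-x-1),\quad r(x)=\tilde\chi(x)\chi(x)\frac{\eta_d(x)}{x\,\xi_d(x)},$$ $$\hat{\mathcal F}_{\phi_{\mathbf d}}=r(x)\left[\frac1{\chi(x)}(R-I)+\frac1{\tilde\chi(x)}(TR+I)\beta(-x-1)\right],\qquad B^{(1)}_{\mathbf d,n}(x)=\hat{\mathcal F}_{\phi_{\mathbf d}}[B_n(x)],$$ which is a polynomial in $x$. *)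

(* Defs.v *)
From HB Require Import structures.
From mathcomp Require Import all_boot all_order all_algebra.
From mathcomp Require Import all_classical all_reals all_analysis.
From mathcomp Require Import ring.
Set Implicit Arguments.
Unset Strict Implicit.
Unset Printing Implicit Defensive.
Import Order.TTheory GRing.Theory Num.Theory.
Import numFieldNormedType.Exports.
Local Open Scope ring_scope.
Local Open Scope classical_set_scope.

(* The Gamma function by the Euler-Gauss limit n! n^z / (z (z+1) ... (z+n)),
   which converges for every real z other than 0, -1, -2, ...; at those poles
   the value is meaningless. *)
Definition Gamma (R : realType) (z : R) : R :=
  lim ((fun n : nat =>
    n`!%:R * (n%:R `^ z) / \prod_(0 <= k < n.+1) (z + k%:R)) @ \oo).

Definition opR (R : realType) (f : R -> R) : R -> R := fun x => f (- x).
Definition opT (R : realType) (f : R -> R) : R -> R := fun x => f (x + 1).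

Record params (R : realType) := Params { rho1 : R; rho2 : R; r1 : R; r2 : R }.

Section BannaiIto.
Variables (R : realType) (S : params R).

Definition alpha (x : R) : R := (x - rho1 S) * (x - rho2 S) / (- (2 * x)).

Definition beta (x : R) : R :=
  (x - r1 S + 1 / 2) * (x - r2 S + 1 / 2) / (2 * x + 1).

Definition opH (f : R -> R) : R -> R := fun x =>
  alpha x * (opR f x - f x) + beta x * (opT (opR f) x - f x).

Definition lambda (n : nat) : R :=
  if odd n then r1 S + r2 S - rho1 S - rho2 S - n.+1%:R / 2 else n%:R / 2.

(* The two excluded points are the poles of alpha and beta, where the total
   division of the library does not return the value of the rational function
   H[p]. *)
Definition is_BI (n : nat) (p : {poly R}) : Prop :=
  [/\ p \is monic, size p = n.+1 &
      forall x : R, x != 0 -> 2 * x + 1 != 0 ->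
        opH (horner p) x = lambda n * p.[x]].

Definition BI (n : nat) : {poly R} := xget 0 [set p | is_BI n p].

(* Only d = 1, ..., 8 is meaningful here and in xi, eta; larger values and 0
   fall into the last case. *)
Definition sigma (d : nat) : params R :=
  let: Params p1 p2 s1 s2 := S in
  match d with
  | 1 => Params p1 p2 s1 s2
  | 2 => Params (- p1) (- p2) (- s1) (- s2)
  | 3 => Params (- p1) (- p2) s1 s2
  | 4 => Params p1 p2 (- s1) (- s2)
  | 5 => Params (- p1) p2 (- s1) s2
  | 6 => Params p1 (- p2) s1 (- s2)
  | 7 => Params p1 (- p2) (- s1) s2
  | _ => Params (- p1) p2 s1 (- s2)
  end.

Definition gfun (s x : R) : R := Gamma (1 / 2 + s + x) * Gamma (1 / 2 + s - x).
Definition qfun (p x : R) : R := Gamma (p - x) * Gamma (1 + p + x).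

Definition xi (d : nat) (x : R) : R :=
  let g1 := gfun (r1 S) x in let g2 := gfun (r2 S) x in
  let q1 := qfun (rho1 S) x in let q2 := qfun (rho2 S) x in
  match d with
  | 1 => 1
  | 2 => (g1 * g2) / (q1 * q2)
  | 3 => 1 / (q1 * q2)
  | 4 => g1 * g2
  | 5 => g1 / q1
  | 6 => g2 / q2
  | 7 => g1 / q2
  | _ => g2 / q1
  end.

Definition eta (d : nat) (x : R) : R :=
  match d with
  | 1 | 4 => 1
  | 2 | 3 => (x - rho1 S) * (x - rho2 S)
  | 6 | 7 => x - rho2 S
  | _ => x - rho1 S
  end.

End BannaiIto.

Section Exceptional.
Variables (R : realType) (S : params R) (d m : nat).

Definition phi (x : R) : R := xi S d x * (BI (sigma S d) m).[x].

Definition chi (x : R) : R := phi x - phi (- x).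

Definition chit (x : R) : R :=
  beta S (- x - 1) * phi x + beta S x * phi (- x - 1).

Definition rfun (x : R) : R := chit x * chi x * (eta S d x / (x * xi S d x)).

(* F^ = r(x) [1/chi(x) (R - I) + 1/chit(x) (TR + I) beta(-x-1)] with the
   products r/chi and r/chit simplified.  The simplification matters when chi
   or chit vanishes identically: for (d, m) = (2, 0) one has chit = 0, but
   r/chit is still a nonzero function.  Elsewhere FhatE below gives the
   unsimplified form. *)
Definition Fhat (f : R -> R) (x : R) : R :=
  (chit x * (eta S d x / (x * xi S d x))) * (opR f x - f x)
  + (chi x * (eta S d x / (x * xi S d x)))
    * (opT (opR (fun y => beta S (- y - 1) * f y)) x + beta S (- x - 1) * f x).

Lemma FhatE (f : R -> R) (x : R) : chi x != 0 -> chit x != 0 ->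
  Fhat f x = rfun x *
    (1 / chi x * (opR f x - f x)
     + 1 / chit x *
       (opT (opR (fun y => beta S (- y - 1) * f y)) x
        + beta S (- x - 1) * f x)).
Proof.
move=> c0 ct0; rewrite /Fhat /rfun.
move: (eta S d x / _) (opR f x - f x) (opT _ x + _) => e u v.
by field; rewrite c0 ct0.
Qed.

(* The polynomial equal to Fhat[B_n] as a function.  The countable exceptional
   set accounts for the poles of the Gamma functions, of alpha and beta, and of
   the factor 1/x; two polynomials that agree off a countable set are equal. *)
Definition B1 (n : nat) : {poly R} :=
  xget 0 [set P : {poly R} |
    countable [set x | Fhat (horner (BI S n)) x <> P.[x]]].

End Exceptional.

(* In particular p is not the zero polynomial. *)
Definition has_degree (R : realType) (p : {poly R}) (k : nat) : Prop :=
  size p = k.+1.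

(* Main.v *)
Require Import Defs.
From mathcomp Require Import all_boot all_order all_algebra.
From mathcomp Require Import all_classical all_reals all_analysis.
From mathcomp Require Import finmap ring lra zify.
Import Order.TTheory GRing.Theory Num.Theory.
Import numFieldNormedType.Exports.
Local Open Scope ring_scope.
Set Implicit Arguments.
Unset Strict Implicit.
Unset Printing Implicit Defensive.

(** Let b(x) = (x-r1+1/2)(x-r2+1/2), so that b(-x-1) = (x+r1+1/2)(x+r2+1/2).
    The list sigma_d changes the sign of some of the parameters.  Let eta
    collect the factors x - rho_j of the rho_j whose sign changes, theta the
    factors x + r_i + 1/2 of the r_i whose sign changes, and kappa those of
    the remaining r_i; then theta kappa = b(-x-1).  The gauge factor xi_d
    consists of the matching g_i and 1/q_j, and the functional equation of
    Gamma turns into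
      eta(x) xi(-x) = xi(x) eta(-x),
      b(x) xi(-x-1) = xi(x) theta(x) kappa(-x-1).
    With p = p_m, f = B_n and F = theta kappa f this makes x(2x+1) Fhat[f]
    equal to the polynomial
      eta theta (kappa p - (kappa p)(-x-1)) (f - f(-x))
        - (eta p - (eta p)(-x)) (F - F(-x-1))
    ([Fhat_numerator]).  Each of its two terms contains a difference that is
    odd under x -> -x and one that is odd under x -> -x-1, hence is divisible
    by x(2x+1), and Fhat[f] is a polynomial of degree two less.

    It remains to find the degree of this numerator.  A difference
    g - g(-x-d) with g monic of degree N has leading term 2 x^N when N is odd
    and loses at least one degree when N is even.  With e = deg eta, this shows
    that the coefficient of x^(m+e+n+2) in the numerator always cancels.  Let s
    be the sum of the r_i that keep their sign and the rho_j that change it,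
    let t = r1 + r2 - s and c = r1 + r2 - rho1 - rho2.  The coefficient of
    x^(m+e+n+1) is
      2(n - 2(r1+r2))  for m+e odd,  n even,
      2(2t + m - n)    for m+e odd,  n odd,
      2(2s - m)        for m+e even, n odd,
      0                for m+e even, n even,
    and in the last case the coefficient of x^(m+e+n) is
      (n - 2(r1+r2)) (2s - m) c (2t + m - n) / (2 (n - c) (m - c + 2t)).
    The last value needs the subleading coefficients of p and f, which the
    eigenvalue equation determines ([BI_subleading]); the product form comes
    from the factorization in [subleading_factor].  The non-integrality
    conditions keep these factors from vanishing, except that for d = 1, where
    t = 0, the factor 2t + m - n vanishes at n = m, the value omitted from the
    list, and that for d = 4, where s = 0, the factor 2s - m vanishes at m = 0.

    The only analytic input is that the Euler-Gauss limit exists and is nonzero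
    off the integers ([gammaConv_notint]), which gives the functional equation
    of Gamma there. *)

(** * The Gamma function off the integers *)
Definition gammaSeq (R : realType) (z : R) (n : nat) : R :=
  n`!%:R * (n%:R `^ z) / \prod_(0 <= k < n.+1) (z + k%:R).

Lemma notint_neq0 (R : realType) (z : R) : z \isn't a Num.int -> z != 0.
Proof. by apply: contraNneq => ->. Qed.

Lemma prod_shift_neq0 (R : realType) (z : R) n : z \isn't a Num.int ->
  \prod_(0 <= k < n) (z + k%:R) != 0.
Proof.
move=> hz; rewrite prodf_seq_neq0; apply/allP => k _ /=.
by apply: notint_neq0; rewrite rpredDr // natr_int.
Qed.

Lemma gammaSeq_succ (R : realType) (z : R) n : z \isn't a Num.int ->
  gammaSeq (z + 1) n.+1 = gammaSeq z n.+1 * (z * (n.+1%:R / (z + n.+2%:R))).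
Proof.
move=> hz; rewrite /gammaSeq.
have z0 := notint_neq0 hz.
have hn : z + n.+2%:R != 0 by apply: notint_neq0; rewrite rpredDr // natr_int.
have P0 := prod_shift_neq0 n.+2 hz.
have hz1 : z + 1 \isn't a Num.int by rewrite rpredDr ?rpred1.
have P1 := prod_shift_neq0 n.+2 hz1.
have E : z * \prod_(0 <= k < n.+2) (z + 1 + k%:R) =
    \prod_(0 <= k < n.+2) (z + k%:R) * (z + n.+2%:R).
  rewrite -(@big_nat_recr _ _ _ _ _ (fun k => z + k%:R)) //=.
  rewrite [RHS]big_nat_recl // addr0; congr (_ * _).
  by apply: eq_bigr => i _; rewrite -addrA -natr1 (addrC 1).
have -> : n.+1%:R `^ (z + 1) = n.+1%:R `^ z * n.+1%:R :> R.
  by rewrite powRD ?powRr1 ?ler0n // pnatr_eq0 implybT.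
move: (\prod_(0 <= k < n.+2) (z + 1 + k%:R)) P1 E => Q Q0 E.
move: (\prod_(0 <= k < n.+2) (z + k%:R)) P0 E => P P0 E.
have -> : Q = P * (z + n.+2%:R) / z by rewrite -E; field.
by field; rewrite -(natrD _ 2 n) hn z0 P0.
Qed.

(** The limit is required to be nonzero because values of Gamma occur in
    denominators. *)
Definition gammaConv (R : realType) (z : R) :=
  exists2 l : R, l != 0 & (gammaSeq z @ \oo --> l)%classic.

Lemma ratio_cvg1 (R : realType) (z : R) :
  ((fun n : nat => n.+1%:R / (z + n.+2%:R)) @ \oo --> (1 : R))%classic.
Proof.
rewrite (_ : (fun _ => _) = (fun n => (1 + (z + 1) * harmonic n)^-1)); last first.
  apply/funext => n; rewrite /harmonic /=.
  have -> : 1 + (z + 1) / n.+1%:R = (z + n.+2%:R) / n.+1%:R.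
    by rewrite -[n.+2%:R]natr1; field; rewrite addrC natr1.
  by rewrite invf_div.
have h : ((fun n => 1 + (z + 1) * harmonic n) @ \oo --> 1 + (z + 1) * 0)%classic.
  apply: cvgD; first exact: cvg_cst.
  by apply: cvgM; [exact: cvg_cst|exact: cvg_harmonic].
rewrite mulr0 addr0 in h.
by have := cvgV (oner_neq0 R) h; rewrite invr1; apply.
Qed.

Lemma gammaSeq_succ_cvg (R : realType) (z l : R) : z \isn't a Num.int ->
  (gammaSeq z @ \oo --> l -> gammaSeq (z + 1) @ \oo --> z * l)%classic.
Proof.
move=> hz hl; rewrite -cvg_shiftS (_ : z * l = l * (z * 1)); last by ring.
rewrite (_ : [sequence _]_n = (fun n =>
  gammaSeq z n.+1 * (z * (n.+1%:R / (z + n.+2%:R))))); last first.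
  by apply/funext => n /=; rewrite gammaSeq_succ.
apply: cvgM; first by move: hl; rewrite -cvg_shiftS.
apply: cvgM; [exact: cvg_cst|exact: ratio_cvg1].
Qed.

Lemma gammaConv_succ (R : realType) (z : R) : z \isn't a Num.int ->
  gammaConv z -> gammaConv (z + 1).
Proof.
move=> hz [l l0 hl]; exists (z * l); first by rewrite mulf_neq0 // notint_neq0.
exact: gammaSeq_succ_cvg.
Qed.

Lemma gammaConv_pred (R : realType) (z : R) : z \isn't a Num.int ->
  gammaConv (z + 1) -> gammaConv z.
Proof.
move=> hz [l l0 hl]; exists (l * (z * 1)^-1).
  by rewrite mulr1 mulf_neq0 // invr_neq0 // notint_neq0.
rewrite -cvg_shiftS.
rewrite (_ : [sequence _]_n = (fun n =>
  gammaSeq (z + 1) n.+1 * (z * (n.+1%:R / (z + n.+2%:R)))^-1)); last first.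
  apply/funext => n /=; rewrite gammaSeq_succ // mulfK //.
  have hn : z + n.+2%:R != 0 by apply: notint_neq0; rewrite rpredDr // natr_int.
  by rewrite !mulf_neq0 ?invr_neq0 ?pnatr_eq0 // notint_neq0.
have h1 : ((fun n => gammaSeq (z + 1) n.+1) @ \oo --> l)%classic.
  by move: hl; rewrite -cvg_shiftS.
have z1 : z * 1 != 0 by rewrite mulr1 notint_neq0.
have h : ((fun n : nat => z * (n.+1%:R / (z + n.+2%:R))) @ \oo --> z * 1)%classic.
  by apply: cvgM; [exact: cvg_cst|exact: ratio_cvg1].
by have := cvgM h1 (cvgV z1 h); apply.
Qed.

(** Bernoulli's inequality for exponents in the unit interval.  Writing
    A = exp L, it is, after division by A^z, the convex combination, with weights 1 - z and z, of the
    two bounds 1 + y <= exp y at y = - z L and y = (1 - z) L. *)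
Lemma powR_le_linear (R : realType) (z A : R) : 0 <= z <= 1 -> 0 < A ->
  A `^ z <= 1 + z * (A - 1).
Proof.
move=> /andP[z0 z1] A0; rewrite /powR gt_eqF //.
set L := ln A; have eA : A = expR L by rewrite lnK.
have e0 := expR_gt0 (z * L).
have h1 := expR_ge1Dx ((1 - z) * L).
have h2 := expR_ge1Dx (- (z * L)).
have e1 : A = expR (z * L) * expR ((1 - z) * L).
  by rewrite -expRD eA; congr expR; ring.
have e2 : expR (z * L) * expR (- (z * L)) = 1 by rewrite expRN divff // gt_eqF.
have -> : 1 + z * (A - 1) = (1 - z) * (expR (z * L) * expR (- (z * L))) +
    z * (expR (z * L) * expR ((1 - z) * L)) by rewrite e2 -e1; ring.
have -> : (1 - z) * (expR (z * L) * expR (- (z * L))) +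
    z * (expR (z * L) * expR ((1 - z) * L)) =
   expR (z * L) * ((1 - z) * expR (- (z * L)) + z * expR ((1 - z) * L)) by ring.
apply: ler_peMr; first exact: ltW.
have g1 : (1 - z) * (1 + - (z * L)) <= (1 - z) * expR (- (z * L)).
  by rewrite ler_wpM2l // subr_ge0.
have g2 : z * (1 + (1 - z) * L) <= z * expR ((1 - z) * L) by rewrite ler_wpM2l.
have e3 : (1 - z) * (1 + - (z * L)) + z * (1 + (1 - z) * L) = 1 by ring.
by have := lerD g1 g2; rewrite e3.
Qed.

Lemma gammaSeq_step (R : realType) (z : R) n : 0 < z ->
  gammaSeq z n.+2 =
  gammaSeq z n.+1 * ((n.+2%:R / n.+1%:R) `^ z * (n.+2%:R / (z + n.+2%:R))).
Proof.
move=> z0; rewrite /gammaSeq.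
have e : n.+2%:R `^ z = n.+1%:R `^ z * (n.+2%:R / n.+1%:R) `^ z :> R.
  by rewrite -powRM ?divr_ge0 ?ler0n // mulrC divfK // pnatr_eq0.
rewrite e big_nat_recr //= factS natrM.
have h k : z + k%:R != 0 by rewrite gt_eqF // ltr_wpDr.
have P0 : \prod_(0 <= k < n.+2) (z + k%:R) != 0.
  by rewrite prodf_seq_neq0; apply/allP => k _ /=.
by field; rewrite ?P0 -?(natrD _ 2 n) ?h.
Qed.

Lemma gammaSeq_gt0 (R : realType) (z : R) n : 0 < z -> 0 < gammaSeq z n.+1.
Proof.
move=> z0; rewrite /gammaSeq divr_gt0 ?mulr_gt0 ?powR_gt0 ?ltr0n ?fact_gt0 //.
by rewrite prodr_gt0 // => k _; rewrite ltr_wpDr.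
Qed.

(** On the unit interval the Euler-Gauss sequence u_n increases while
    u_n (1 + z/n) decreases, both by Bernoulli's inequality applied to
    consecutive ratios; a bounded increasing positive sequence has a positive
    limit. *)
Lemma gammaConv01 (R : realType) (z : R) : 0 < z < 1 -> gammaConv z.
Proof.
move=> /andP[z0 z1].
have z01 : 0 <= z <= 1 by rewrite !ltW.
pose w n := gammaSeq z n.+1.
have w0 n : 0 < w n by exact: gammaSeq_gt0.
have N0 n : (0 : R) < n.+1%:R by rewrite ltr0n.
have wS n : w n.+1 =
    w n * ((n.+2%:R / n.+1%:R) `^ z * (n.+2%:R / (z + n.+2%:R))).
  exact: gammaSeq_step.
have incr : nondecreasing_seq w.
  apply/nondecreasing_seqP => n; rewrite wS.
  apply: ler_peMr; first exact: ltW (w0 n).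
  set B := _ `^ z; set N : R := n.+2%:R.
  have B0 : 0 < B by rewrite powR_gt0 // divr_gt0.
  have BC : B * (n.+1%:R / N) `^ z = 1.
    rewrite -powRM ?divr_ge0 ?ler0n // (_ : _ * _ = 1) ?powR1 //.
    by rewrite mulrA divfK ?divff // gt_eqF.
  have NN : 0 < N by exact: N0.
  have hN : n.+1%:R = N - 1 by rewrite /N -[n.+2%:R]natr1 addrK.
  have : B * (n.+1%:R / N) `^ z <= B * (1 - z / N).
    rewrite ler_wpM2l ?(ltW B0) //.
    apply: le_trans (powR_le_linear z01 _) _; first by rewrite divr_gt0.
    rewrite le_eqVlt; apply/orP; left; apply/eqP; rewrite hN.
    by field; rewrite gt_eqF.
  rewrite BC => h.
  have h2 : N <= B * (N - z).
    have -> : B * (N - z) = B * (1 - z / N) * N by field; rewrite gt_eqF.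
    by rewrite ler_peMl // ltW.
  rewrite mulrA ler_pdivlMr ?mul1r; last by rewrite addr_gt0.
  have h3 : N * (N + z) <= B * (N - z) * (N + z).
    by rewrite ler_wpM2r // ltW // addr_gt0.
  have h4 : 0 <= B * z ^+ 2 by rewrite mulr_ge0 ?sqr_ge0 // ltW.
  rewrite -(ler_pM2l NN); lra.
have ub n : w n * (1 + z / n.+1%:R) <= w 0%N * (1 + z).
  elim: n => [|n IH]; first by rewrite divr1.
  apply: le_trans IH; rewrite wS -mulrA ler_wpM2l ?(ltW (w0 _)) //.
  have -> : (n.+2%:R / n.+1%:R) `^ z * (n.+2%:R / (z + n.+2%:R)) *
      (1 + z / n.+2%:R) = (n.+2%:R / n.+1%:R) `^ z.
    by field; rewrite -?(natrD _ 2 n) !gt_eqF // addr_gt0.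
  apply: le_trans (powR_le_linear z01 _) _; first by rewrite divr_gt0.
  rewrite -[n.+2%:R]natr1 le_eqVlt; apply/orP; left; apply/eqP.
  by field; rewrite addrC natr1 gt_eqF.
have ub' n : w n <= w 0%N * (1 + z).
  apply: le_trans (ub n); rewrite ler_peMr ?(ltW (w0 _)) // lerDl.
  by rewrite divr_ge0 // ltW.
have cv : cvgn w.
  apply: nondecreasing_is_cvgn => //.
  by exists (w 0%N * (1 + z)) => _ [n _ <-]; exact: ub'.
exists (limn w); last by rewrite -cvg_shiftS.
apply: lt0r_neq0; apply: lt_le_trans (w0 0%N) _.
exact: nondecreasing_cvgn_le.
Qed.

(** The relation between the sequences at z and z + 1 transports convergence in
    both directions, so that only the fractional part of z matters. *)
Lemma gammaConv_notint (R : realType) (z : R) :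
  z \isn't a Num.int -> gammaConv z.
Proof.
move=> hz.
have up (y : R) k : y \isn't a Num.int -> gammaConv y <-> gammaConv (y + k%:R).
  move=> hy; elim: k => [|k IH]; first by rewrite addr0.
  rewrite -natr1 addrA IH; split; [apply: gammaConv_succ|apply: gammaConv_pred];
  by rewrite rpredDr // natr_int.
pose y := z - (Num.floor z)%:~R.
have hy : y \isn't a Num.int by rewrite rpredBr // intr_int.
have gy : gammaConv y.
  have := floor_itv z; rewrite intrD => /andP[lo hi].
  apply: gammaConv01; apply/andP; split; last by rewrite /y; lra.
  rewrite lt_neqAle /y subr_ge0 lo andbT eq_sym.
  exact: notint_neq0.
have zE : z = y + (Num.floor z)%:~R by rewrite subrK.
case: (Num.floor z) zE => k zE.
  by rewrite zE; apply/(up y k).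
apply/(up z k.+1) => //.
by rewrite zE NegzE mulrNz addrNK.
Qed.

Lemma Gamma_neq0 (R : realType) (z : R) : z \isn't a Num.int -> Gamma z != 0.
Proof.
by move=> /gammaConv_notint [l l0 hl]; rewrite /Gamma (cvg_lim _ hl).
Qed.

Lemma Gamma_succ (R : realType) (z : R) : z \isn't a Num.int ->
  Gamma (z + 1) = z * Gamma z.
Proof.
move=> hz; have [l l0 hl] := gammaConv_notint hz.
rewrite /Gamma (cvg_lim _ hl) //; apply: cvg_lim => //.
exact: gammaSeq_succ_cvg.
Qed.

(** * Leading coefficients of polynomials *)

(** The three coefficients of p at the degrees N, N-1 and N-2, where N bounds
    the degree but need not equal it.  Multiplying by X^2 avoids negative
    exponents when N < 2; coefficients at negative degrees are then forced to
    be 0. *)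
Definition leads (R : realFieldType) (N : nat) (a0 a1 a2 : R) (p : {poly R}) :=
  (size ('X^2 * p - (a0 *: 'X^2 + a1 *: 'X + a2%:P) * 'X^N)%R <= N)%N.

Section LeadingCoefficients.
Variable R : realFieldType.
Implicit Types (p q : {poly R}) (a b c d : R) (N M : nat).

Lemma leadsP N a0 a1 a2 p : leads N a0 a1 a2 p ->
  exists2 r : {poly R}, (size r <= N)%N &
    'X^2 * p = (a0 *: 'X^2 + a1 *: 'X + a2%:P) * 'X^N + r.
Proof.
move=> h; exists ('X^2 * p - (a0 *: 'X^2 + a1 *: 'X + a2%:P) * 'X^N) => //.
by rewrite addrC subrK.
Qed.

Lemma leadsI N a0 a1 a2 p (r : {poly R}) : (size r <= N)%N ->
    'X^2 * p = (a0 *: 'X^2 + a1 *: 'X + a2%:P) * 'X^N + r ->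
  leads N a0 a1 a2 p.
Proof. by move=> h e; rewrite /leads e addrC addKr. Qed.

Lemma size_lin_leq a1 a2 : (size (a1 *: 'X + a2%:P)%R <= 2)%N.
Proof.
rewrite (leq_trans (size_polyD _ _)) // geq_max (leq_trans (size_scale_leq _ _)).
  by rewrite (leq_trans (size_polyC_leq1 _)).
by rewrite size_polyX.
Qed.

Lemma size_quad a0 a1 a2 : (size (a0 *: 'X^2 + a1 *: 'X + a2%:P)%R <= 3)%N.
Proof.
rewrite -addrA (leq_trans (size_polyD _ _)) // geq_max.
rewrite (leq_trans (size_scale_leq _ _)) ?size_polyXn //.
by rewrite (leq_trans (size_lin_leq _ _)).
Qed.

Lemma leads_lin N c d a0 a1 a2 b0 b1 b2 p q :
  leads N a0 a1 a2 p -> leads N b0 b1 b2 q ->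
  leads N (c * a0 + d * b0) (c * a1 + d * b1) (c * a2 + d * b2) (c *: p + d *: q).
Proof.
move=> /leadsP [r hr er] /leadsP [s hs es].
apply: (@leadsI _ _ _ _ _ (c *: r + d *: s)).
  rewrite !(leq_trans (size_polyD _ _)) // geq_max.
  by rewrite !(leq_trans (size_scale_leq _ _)).
rewrite mulrDr -!scalerAr er es -!mul_polyC !rmorphD !rmorphM /=.
ring.
Qed.

Lemma leads_eq N a0 a1 a2 b0 b1 b2 p : leads N a0 a1 a2 p ->
  a0 = b0 -> a1 = b1 -> a2 = b2 -> leads N b0 b1 b2 p.
Proof. by move=> h <- <- <-. Qed.

Lemma leadsD N a0 a1 a2 b0 b1 b2 p q :
  leads N a0 a1 a2 p -> leads N b0 b1 b2 q ->
  leads N (a0 + b0) (a1 + b1) (a2 + b2) (p + q).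
Proof. by move=> h1 h2; move: (leads_lin 1 1 h1 h2); rewrite !scale1r !mul1r. Qed.

Lemma leadsB N a0 a1 a2 b0 b1 b2 p q :
  leads N a0 a1 a2 p -> leads N b0 b1 b2 q ->
  leads N (a0 - b0) (a1 - b1) (a2 - b2) (p - q).
Proof.
move=> h1 h2; move: (leads_lin 1 (-1) h1 h2).
by rewrite scale1r scaleN1r !mul1r !mulN1r.
Qed.

Lemma leadsZ N c a0 a1 a2 p :
  leads N a0 a1 a2 p -> leads N (c * a0) (c * a1) (c * a2) (c *: p).
Proof.
by move=> h; move: (leads_lin c 0 h h); rewrite scale0r addr0 !mul0r !addr0.
Qed.

Lemma size_mulX2 p : size ('X^2 * p)%R = if p == 0 then 0%N else (size p).+2.
Proof.
rewrite mulrC; case: eqP => [->|/eqP p0]; first by rewrite mul0r size_poly0.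
by rewrite size_mulXn.
Qed.

(** Besides the terms that contribute to the three top coefficients, the
    product has terms of degree at least three below the top; after
    multiplication by X^4 they all have degree less than N + M + 2. *)
Lemma leadsM N M a0 a1 a2 b0 b1 b2 p q :
  leads N a0 a1 a2 p -> leads M b0 b1 b2 q ->
  leads (N + M) (a0 * b0) (a0 * b1 + a1 * b0) (a0 * b2 + a1 * b1 + a2 * b0)
    (p * q).
Proof.
move=> /leadsP [r hr er] /leadsP [s hs es].
rewrite /leads; set w := _ - _.
suff: (size ('X^2 * w)%R <= (N + M).+2)%N.
  by rewrite size_mulX2; case: eqP => [->|_]; rewrite ?size_poly0.
pose lo := (a1 * b2 + a2 * b1) *: 'X + (a2 * b2)%:P : {poly R}.
have -> : 'X^2 * w = lo * 'X^(N + M) +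
    ((a0 *: 'X^2 + a1 *: 'X + a2%:P) * 'X^N * s +
     (b0 *: 'X^2 + b1 *: 'X + b2%:P) * 'X^M * r + r * s).
  rewrite /w mulrBr.
  have -> : 'X^2 * ('X^2 * (p * q)) = ('X^2 * p) * ('X^2 * q) by ring.
  rewrite er es /lo exprD -!mul_polyC !rmorphD !rmorphM /=; ring.
have szlo : (size lo <= 2)%N by exact: size_lin_leq.
have h1 : (size (lo * 'X^(N + M))%R <= (N + M).+2)%N.
  by rewrite (leq_trans (size_polyMleq _ _)) // size_polyXn; lia.
have szq (x0 x1 x2 : R) K (t : {poly R}) L : (size t <= L)%N ->
   (size ((x0 *: 'X^2 + x1 *: 'X + x2%:P) * 'X^K * t)%R <= (K + L).+2)%N.
  move=> ht; rewrite (leq_trans (size_polyMleq _ _)) //.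
  have : (size ((x0 *: 'X^2 + x1 *: 'X + x2%:P) * 'X^K)%R <= K.+3)%N.
    rewrite (leq_trans (size_polyMleq _ _)) // size_polyXn.
    by have := size_quad x0 x1 x2; lia.
  lia.
have h2 := szq a0 a1 a2 N s M hs.
have h3 := szq b0 b1 b2 M r N hr.
have h4 : (size (r * s)%R <= (N + M).+2)%N.
  by rewrite (leq_trans (size_polyMleq _ _)) //; lia.
apply: leq_trans (size_polyD _ _) _; rewrite geq_max h1 /=.
apply: leq_trans (size_polyD _ _) _; rewrite geq_max h4 andbT.
by apply: leq_trans (size_polyD _ _) _; rewrite geq_max h2 addnC h3.
Qed.

Lemma leads_uniq N a0 a1 a2 b0 b1 b2 p :
  leads N a0 a1 a2 p -> leads N b0 b1 b2 p -> [/\ a0 = b0, a1 = b1 & a2 = b2].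
Proof.
move=> /leadsP [r hr er] /leadsP [s hs]; rewrite er => E.
have C j : (r`_(N + j) = 0) /\ (s`_(N + j) = 0).
  by rewrite !nth_default // (leq_trans _ (leq_addr _ _)).
have K j : ((a0 *: 'X^2 + a1 *: 'X + a2%:P) * 'X^N + r)`_(N + j) =
           ((b0 *: 'X^2 + b1 *: 'X + b2%:P) * 'X^N + s)`_(N + j) by rewrite E.
have L j : (a0 *: 'X^2 + a1 *: 'X + a2%:P)`_j = (b0 *: 'X^2 + b1 *: 'X + b2%:P)`_j.
  have := K j; rewrite coefD [in RHS]coefD !coefMXn; have [-> ->] := C j.
  by rewrite !addr0 ltnNge leq_addr /= addKn.
move: (L 0%N) (L 1%N) (L 2%N); rewrite !coefD !coefZ !coefXn !coefX !coefC /=.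
by rewrite ?mulr0n ?mulr1n !(mulr0, mulr1, addr0, add0r) => -> -> ->.
Qed.

Lemma leads_exists N p : (size p <= N.+1)%N ->
  exists a0, exists a1, exists a2, leads N a0 a1 a2 p.
Proof.
move=> hp; exists (('X^2 * p)`_N.+2), (('X^2 * p)`_N.+1), (('X^2 * p)`_N).
apply/leq_sizeP => j hj.
rewrite coefB coefMXn ltnNge hj /= -(subnKC hj) addKn.
case: (j - N)%N => [|[|[|k]]];
  rewrite !coefD !coefZ !coefXn !coefX !coefC /= ?(mulr0, mulr1, addr0, add0r)
    ?addn0 ?addn1 ?addn2 ?subrr //.
rewrite subr0 nth_default // mulrC (leq_trans (size_polyMleq _ _)) //.
rewrite size_polyXn; lia.
Qed.

Lemma leads_size N a0 a1 a2 p : leads N a0 a1 a2 p -> (size p <= N.+1)%N.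
Proof.
move=> /leadsP [r hr er].
have : (size ('X^2 * p)%R <= N.+3)%N.
  rewrite er (leq_trans (size_polyD _ _)) // geq_max.
  rewrite (leq_trans (size_polyMleq _ _)) ?size_polyXn; last first.
    by have := size_quad a0 a1 a2; lia.
  lia.
by rewrite size_mulX2; case: eqP => [->|_]; rewrite ?size_poly0.
Qed.

Lemma leads_size1 N a1 a2 p : leads N 0 a1 a2 p -> (size p <= N)%N.
Proof.
move=> /leadsP [r hr er].
have : (size ('X^2 * p)%R <= N.+2)%N.
  rewrite er (leq_trans (size_polyD _ _)) // geq_max.
  have h : (size ((0 : R) *: 'X^2 + a1 *: 'X + a2%:P)%R <= 2)%N.
    by rewrite scale0r add0r size_lin_leq.
  rewrite (leq_trans (size_polyMleq _ _)) ?size_polyXn; last by lia.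
  lia.
by rewrite size_mulX2; case: eqP => [->|_]; rewrite ?size_poly0.
Qed.

Lemma leads_size2 N a2 p : leads N.+1 0 0 a2 p -> (size p <= N)%N.
Proof.
move=> /leadsP [r hr er].
have : (size ('X^2 * p)%R <= N.+2)%N.
  rewrite er !scale0r !add0r mul_polyC (leq_trans (size_polyD _ _)) // geq_max.
  by rewrite (leq_trans (size_scale_leq _ _)) ?size_polyXn //= (leq_trans hr).
by rewrite size_mulX2; case: eqP => [->|_]; rewrite ?size_poly0.
Qed.

Lemma leads_sizeE1 N a1 a2 p : leads N 0 a1 a2 p -> a1 != 0 -> size p = N.
Proof.
move=> h a10; apply/eqP; rewrite eqn_leq (leads_size1 h) /=.
move/leadsP: h => [r hr er].
have : (N.+2 <= size ('X^2 * p)%R)%N.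
  rewrite ltnNge; apply: contraNN a10 => /leq_sizeP /(_ N.+1 (leqnn _)).
  rewrite er coefD coefMXn ltnNge leqnSn /= subSnn.
  rewrite !coefD !coefZ !coefXn coefX coefC.
  by rewrite nth_default ?(leq_trans hr) //= ?(mulr0, mulr1, addr0, add0r) => ->.
by rewrite size_mulX2; case: eqP.
Qed.

Lemma leads_sizeE2 N a2 p : leads N 0 0 a2 p -> a2 != 0 -> (size p).+1 = N.
Proof.
move=> h a20.
move/leadsP: h => [r hr er].
suff : size ('X^2 * p)%R = N.+1 by rewrite size_mulX2; case: eqP => // _ [].
rewrite er !scale0r !add0r mul_polyC size_polyDl ?size_scale ?size_polyXn //.
Qed.

Lemma leads_coef N a0 a1 a2 p : leads N a0 a1 a2 p -> a0 = p`_N.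
Proof.
move=> /leadsP [r hr er].
have: ('X^2 * p)`_N.+2 = p`_N by rewrite mulrC coefMXn /= -addn2 addnK.
have NN : (N <= N.+2)%N by exact: leq_trans (leqnSn _) (leqnSn _).
rewrite er coefD coefMXn !coefD !coefZ !coefXn !coefX !coefC nth_default;
  last exact: leq_trans hr NN.
have -> : (N.+2 - N = 2)%N by rewrite -addn2 addKn.
by rewrite ltnNge NN //= ?(mulr0, mulr1, addr0, add0r).
Qed.

Lemma leads_monic N p : p \is monic -> size p = N.+1 ->
  exists a1, exists a2, leads N 1 a1 a2 p.
Proof.
move=> /monicP pm sp; have [a0 [a1 [a2 h]]] := @leads_exists N p (eq_leq sp).
by exists a1, a2; have := leads_coef h; rewrite -pm /lead_coef sp /= => <-.
Qed.

Lemma leads_Xn N : leads N 1 0 0 ('X^N : {poly R}).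
Proof.
apply: (@leadsI _ _ _ _ _ 0); rewrite ?size_poly0 //.
by rewrite !scale0r scale1r !addr0.
Qed.

Lemma leads_C c : leads 0 c 0 0 c%:P.
Proof.
apply: (@leadsI _ _ _ _ _ 0); rewrite ?size_poly0 //.
by rewrite -mul_polyC !scale0r expr0; ring.
Qed.

Lemma leads_linear c d : leads 1 c d 0 (c *: 'X + d%:P).
Proof.
by apply: (@leadsI _ _ _ _ _ 0); rewrite ?size_poly0 // -!mul_polyC; ring.
Qed.

Lemma leads_low N p : (size p <= N)%N -> leads N.+2 0 0 0 p.
Proof.
move=> h; apply: (@leadsI _ _ _ _ _ ('X^2 * p)).
  by rewrite size_mulX2; case: eqP.
by rewrite !scale0r !add0r mul0r add0r.
Qed.

Lemma leads_lift N a0 a1 a2 p : leads N a0 a1 a2 p -> leads N.+1 0 a0 a1 p.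
Proof.
move=> /leadsP [r hr er]; apply: (@leadsI _ _ _ _ _ (a2 *: 'X^N + r)).
  rewrite (leq_trans (size_polyD _ _)) // geq_max.
  by rewrite (leq_trans (size_scale_leq _ _)) ?size_polyXn //= (leq_trans hr).
by rewrite er (exprS 'X N) scale0r -!mul_polyC; ring.
Qed.

Lemma leads_expL d N :
  leads N ((-1) ^+ N) ((-1) ^+ N * (N%:R * d))
    ((-1) ^+ N * (N%:R * (N%:R - 1) / 2 * d ^+ 2)) ((- 'X - d%:P) ^+ N).
Proof.
elim: N => [|N IH].
  by apply: leads_eq (leads_C 1) _ _ _ => //; rewrite !mul0r mulr0.
have h := leads_linear (-1) (-d); rewrite scaleN1r polyCN in h.
rewrite exprSr -addn1 exprD expr1.
apply: leads_eq (leadsM IH h) _ _ _; rewrite ?natrD; by field.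
Qed.

(** For L = - X - d, composing X^2 p = (a0 X^2 + a1 X + a2) X^N + r with L gives
    an identity for L^2 (p o L); its top coefficients are those of powers of L,
    and dividing by L^2 amounts to solving a triangular system. *)
Lemma leads_comp d N a0 a1 a2 p : leads N a0 a1 a2 p ->
  leads N ((-1) ^+ N * a0) ((-1) ^+ N * (N%:R * d * a0 - a1))
    ((-1) ^+ N *
      (N%:R * (N%:R - 1) / 2 * d ^+ 2 * a0 - (N%:R - 1) * d * a1 + a2))
    (p \Po (- 'X - d%:P)).
Proof.
move=> ht; set s := (-1) ^+ N; have szp := leads_size ht.
pose L : {poly R} := - 'X - d%:P.
have szL : size L = 2%N by rewrite /L -opprD size_polyN size_XaddC.
have [b0 [b1 [b2 hb]]] :
    exists b0, exists b1, exists b2, leads N b0 b1 b2 (p \Po L).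
  by apply: leads_exists; rewrite size_comp_poly2.
move/leadsP: ht => [r hr er].
have E : L ^+ 2 * (p \Po L) =
   a0 *: L ^+ N.+2 + a1 *: L ^+ N.+1 + a2 *: L ^+ N + (r \Po L).
  have := congr1 (fun q => q \Po L) er.
  rewrite !(comp_polyM, comp_polyD, comp_polyZ, comp_polyC, comp_Xn_poly,
    comp_polyX).
  by move=> ->; rewrite -!mul_polyC !exprS; ring.
have t1 := leadsM (leads_expL d 2) hb.
rewrite addnC addn2 E in t1.
have t2 := leads_low (leq_trans (eq_leq (size_comp_poly2 r szL)) hr).
have q0 := leadsZ a0 (leads_expL d N.+2).
have q1 := leadsZ a1 (leads_lift (leads_expL d N.+1)).
have q2 := leadsZ a2 (leads_lift (leads_lift (leads_expL d N))).
have t3 := leadsD (leadsD (leadsD q0 q1) q2) t2.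
have [e0 e1 e2] := leads_uniq t1 t3.
have sg2 : (-1) ^+ N.+2 = s by rewrite 2!exprS mulrA mulrNN !mul1r.
have sg1 : (-1) ^+ N.+1 = - s by rewrite exprS mulN1r.
have n2 : N.+2%:R = N%:R + 2 :> R by rewrite -addn2 natrD.
have n1 : N.+1%:R = N%:R + 1 :> R by rewrite -addn1 natrD.
move: e0 e1 e2; rewrite sg2 sg1 n2 n1 sqrrN expr1n -/s => e0 e1 e2.
have f0 : b0 = s * a0 by lra.
have f1 : b1 = s * (N%:R * d * a0 - a1) by move: e1; rewrite f0; lra.
have f2 : b2 =
    s * (N%:R * (N%:R - 1) / 2 * d ^+ 2 * a0 - (N%:R - 1) * d * a1 + a2).
  by move: e2; rewrite f1 f0; lra.
exact: leads_eq hb f0 f1 f2.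
Qed.

End LeadingCoefficients.

(** * The eigenvalue problem with denominators cleared *)
Lemma countable_setU (T : Type) (A B : set T) :
  countable A -> countable B -> countable (A `|` B)%classic.
Proof.
move=> cA cB.
have -> : (A `|` B = \bigcup_(b in [set: bool]) (if b then A else B))%classic.
  apply/seteqP; split=> x /=.
    by case=> h; [exists true|exists false].
  by case=> [[]] _ h; [left|right].
by apply: bigcup_countable => [|[] _ //]; exact: countableP.
Qed.

(** The complement of a countable set of reals is infinite, since the unit
    interval has positive Lebesgue measure. *)
Lemma poly_eq_off_countable (R : realType) (p q : {poly R}) (B : set R) :
  countable B -> (forall x, ~ B x -> p.[x] = q.[x]) -> p = q.
Proof.
move=> cB pq; apply/eqP; rewrite -subr_eq0; apply/eqP.
have inf : infinite_set (~` B)%classic.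
  move=> /finite_set_countable fB.
  have : countable `[0 : R, 1]%classic.
    apply: (@sub_countable _ _ _ (B `|` ~` B)%classic);
      last exact: countable_setU.
    by rewrite setUCr; apply: subset_card_le.
  move/countable_lebesgue_measure0; rewrite lebesgue_measure_itv /= lte_fin.
  by rewrite ltr01 oppr0 adde0 => /eqP; rewrite eqe oner_eq0.
have [C CB sC] := infinite_set_fset (size (p - q)) inf.
apply: (@roots_geq_poly_eq0 _ _ (enum_fset C)) => //; last exact: fset_uniq.
apply/allP => x xC; rewrite rootE !hornerE pq ?subrr //.
exact: CB.
Qed.

Definition lin (R : realType) (c d : R) : {poly R} := c *: 'X + d%:P.

(** The substitution x -> - x - d; the operators R and TR are the cases
    d = 0 and d = 1. *)
Definition mirror (R : realType) (d : R) (p : {poly R}) := p \Po (- 'X - d%:P).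

Definition hornerLinE := (hornerD, hornerN, hornerM, hornerZ, hornerX, hornerC).

Lemma horner_mirror (R : realType) (d x : R) (p : {poly R}) :
  (mirror d p).[x] = p.[- x - d].
Proof. by rewrite /mirror horner_comp !hornerE. Qed.

Lemma horner_lin (R : realType) (c d x : R) : (lin c d).[x] = c * x + d.
Proof. by rewrite /lin !hornerE. Qed.

Section BI.
Variables (R : realType) (S : params R).

(** The operator 2x(2x+1)H, which maps polynomials to polynomials without any
    division. *)
Definition clearedH (p : {poly R}) : {poly R} :=
  lin (-2) (-1) * (lin 1 (- rho1 S) * lin 1 (- rho2 S)) * (mirror 0 p - p) +
  lin 2 0 * (lin 1 (1 / 2 - r1 S) * lin 1 (1 / 2 - r2 S)) * (mirror 1 p - p).

Definition clearedE (l : R) (p : {poly R}) : {poly R} :=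
  clearedH p - l *: (lin 2 0 * lin 2 1 * p).

Lemma opH_cleared (p : {poly R}) x : x != 0 -> 2 * x + 1 != 0 ->
  2 * x * (2 * x + 1) * opH S (horner p) x = (clearedH p).[x].
Proof.
move=> x0 x1; rewrite /clearedH !(hornerLinE, horner_lin, horner_mirror).
rewrite /opH /opR /opT /alpha /beta.
by rewrite [- (x + 1)]opprD subr0; field; rewrite x1 x0.
Qed.

(** The eigenvalue equation off the two poles is equivalent to one polynomial
    identity. *)
Lemma eigen_cleared (p : {poly R}) l :
  (forall x : R, x != 0 -> 2 * x + 1 != 0 -> opH S (horner p) x = l * p.[x]) <->
  clearedE l p = 0.
Proof.
have E x : (clearedE l p).[x] =
    (clearedH p).[x] - 2 * x * (2 * x + 1) * (l * p.[x]).
  by rewrite /clearedE !(hornerLinE, horner_lin); ring.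
split=> [h|h x x0 x1].
  apply: (@poly_eq_off_countable _ _ _ [set 0; - (1 / 2)]%classic).
    by apply: finite_set_countable; exact: finite_set2.
  move=> x /= nx; rewrite E horner0.
  have x0 : x != 0 by apply/eqP => e; apply: nx; left.
  have x1 : 2 * x + 1 != 0 by apply/eqP => e; apply: nx; right; lra.
  by rewrite -opH_cleared // h // subrr.
move/(congr1 (fun q => q.[x])): h; rewrite E horner0 -opH_cleared // -mulrBr.
move/eqP; rewrite mulf_eq0 subr_eq0 => /orP [|/eqP //].
by rewrite !mulf_eq0 (negbTE x0) (negbTE x1) pnatr_eq0.
Qed.

Lemma clearedE_lin l (a : R) p q :
  clearedE l (p + a *: q) = clearedE l p + a *: clearedE l q.
Proof.
rewrite /clearedE /clearedH /mirror !comp_polyD !comp_polyZ -!mul_polyC; ring.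
Qed.

(** The operator H is triangular on the powers of x: it maps x^N to
    lambda_N x^N + subdiag_N x^(N-1) + lower terms. *)
Definition subdiag (N : nat) : R :=
  if odd N then rho1 S * rho2 S - (r1 S - N%:R / 2) * (r2 S - N%:R / 2)
  else N%:R * (N%:R - 2 * (r1 S + r2 S)) / 4.

(** The eigenvalue at N-1, by the formula that also makes sense at N = 0. *)
Definition lambdaPred (N : nat) : R :=
  if odd N then (N%:R - 1) / 2
  else r1 S + r2 S - rho1 S - rho2 S - N%:R / 2.

Lemma leads_clearedE l N a0 a1 a2 p : leads N a0 a1 a2 p ->
  leads N.+3 0 (4 * (lambda S N - l) * a0)
    (4 * (subdiag N * a0 + (lambdaPred N - l) * a1) + 2 * (lambda S N - l) * a0)
    (clearedE l p).
Proof.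
move=> h.
have tr d := leadsB (leads_comp d h) h.
have tl := @leads_linear R.
have ta := leadsM (tl 1 (- rho1 S)) (tl 1 (- rho2 S)).
have tb := leadsM (tl 1 (1 / 2 - r1 S)) (tl 1 (1 / 2 - r2 S)).
have t1 := leadsM (leadsM (tl (-2) (-1)) ta) (tr 0).
have t2 := leadsM (leadsM (tl 2 0) tb) (tr 1).
have t3 := leadsZ l (leads_lift (leadsM (leadsM (tl 2 0) (tl 2 1)) h)).
have t4 := leadsB (leadsD t1 t2) t3.
apply: leads_eq t4 _ _ _;
  rewrite /lambda /subdiag /lambdaPred -?[N.+1%:R]natr1 -signr_odd;
  by case: (odd N); rewrite ?expr0 ?expr1; field.
Qed.

Lemma clearedE_horner0 l (p : {poly R}) : (clearedE l p).[0] = 0.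
Proof.
rewrite /clearedE /clearedH !(hornerLinE, horner_lin, horner_mirror).
have -> : - 0 - 0 = 0 :> R by ring.
ring.
Qed.

Lemma clearedE_hornerN12 l (p : {poly R}) : (clearedE l p).[- (1 / 2)] = 0.
Proof.
rewrite /clearedE /clearedH !(hornerLinE, horner_lin, horner_mirror).
have -> : - - (1 / 2) - 1 = - (1 / 2) :> R by lra.
by field.
Qed.

(** Distinct diagonal entries of a triangular operator give eigenvectors: the
    polynomial starts as x^n, and the coefficients of the residual are removed
    from the top down by adding multiples of x^k, where lambda_k - lambda_n is
    the pivot. *)
Lemma BI_exists n : (forall k, (k < n)%N -> lambda S k != lambda S n) ->
  exists p, is_BI S n p.
Proof.
move=> hl; set l := lambda S n.
have H j : (j <= n)%N -> exists p : {poly R},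
   [/\ p \is monic, size p = n.+1 & (size (clearedE l p) <= (n - j).+2)%N].
  elim: j => [_|j IH jn].
    exists 'X^n; split; rewrite ?monicXn ?size_polyXn // subn0.
    have := leads_clearedE l (leads_Xn R n); rewrite /l subrr mulr0 mul0r.
    exact: leads_size2.
  have [p [pm sp szp]] := IH (ltnW jn).
  set k := (n - j.+1)%N; have kn : (k < n)%N by rewrite /k; lia.
  have ek : (n - j = k.+1)%N by rewrite /k; lia.
  rewrite ek in szp.
  have [e [b [c te]]] := leads_exists szp.
  have tX := leads_clearedE l (leads_Xn R k).
  have dl : lambda S k - l != 0 by rewrite subr_eq0 hl.
  pose a := - e / (4 * (lambda S k - l)).
  exists (p + a *: 'X^k).
  have sX : (size (a *: 'X^k : {poly R}) < size p)%N.
    by rewrite sp (leq_ltn_trans (size_scale_leq _ _)) // size_polyXn.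
  split.
  - by rewrite monicE lead_coefDl // -monicE.
  - by rewrite size_polyDl.
  rewrite clearedE_lin.
  have h := leadsD (leads_lift te) (leadsZ a tX).
  apply: leads_size2 (leads_eq h _ _ erefl); first by rewrite mulr0 addr0.
  by rewrite /a; field.
have [p [pm sp szp]] := H n (leqnn n); rewrite subnn in szp.
exists p; split => //; apply/eigen_cleared.
(* A residual of degree at most 1 vanishes because of its zeros at 0, -1/2. *)
apply: (@roots_geq_poly_eq0 _ _ [:: 0; - (1 / 2)]) => //=.
  by rewrite !rootE clearedE_horner0 clearedE_hornerN12 !eqxx.
by rewrite inE andbT eq_sym oppr_eq0 mul1r invr_eq0 pnatr_eq0.
Qed.

(** The coefficient of x^(m-1) in the eigenvalue equation. *)
Lemma BI_subleading m (p : {poly R}) : is_BI S m p ->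
  exists a, exists2 a2, leads m 1 a a2 p &
    (lambda S m - lambdaPred m) * a = subdiag m.
Proof.
move=> [pm sp /eigen_cleared h].
have [a [a2 t]] := leads_monic pm sp.
exists a, a2 => //.
have := leads_clearedE (lambda S m) t; rewrite h.
have t0 : leads m.+3 0 0 0 (0 : {poly R}).
  by apply: leads_low; rewrite size_poly0.
by move=> /(leads_uniq t0) [_ _]; lra.
Qed.

Lemma lambda_inj n : r1 S + r2 S - rho1 S - rho2 S \isn't a Num.int ->
  forall k, (k < n)%N -> lambda S k != lambda S n.
Proof.
move=> hc k kn.
have half q : odd q = false -> q%:R / 2 = (q./2)%:R :> R.
  move=> oq; rewrite -[in LHS](odd_double_half q) oq add0n -muln2 natrM.
  by field.
rewrite /lambda; case ok: (odd k); case on: (odd n).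
- rewrite (inj_eq (addrI _)) eqr_opp (inj_eq (mulIf _)) ?invr_eq0 ?pnatr_eq0 //.
  by rewrite eqr_nat eqSS neq_ltn kn.
- rewrite !half /= ?ok ?on //; apply: (contraNneq _ hc) => e.
  have -> : r1 S + r2 S - rho1 S - rho2 S = (n./2)%:R + (uphalf k)%:R.
    by rewrite -e; ring.
  by rewrite rpredD ?natr_int.
- rewrite !half /= ?ok ?on //; apply: (contraNneq _ hc) => e.
  have -> : r1 S + r2 S - rho1 S - rho2 S = (k./2)%:R + (uphalf n)%:R.
    by rewrite e; ring.
  by rewrite rpredD ?natr_int.
- by rewrite (inj_eq (mulIf _)) ?invr_eq0 ?pnatr_eq0 // eqr_nat neq_ltn kn.
Qed.

End BI.

(** * Leading coefficients of the numerator *)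
Section Numerator.
Variable R : realType.
Implicit Types (p f : {poly R}).

(** An antisymmetrization keeps the leading term in odd degree and cancels it
    in even degree, where the subleading coefficient takes its place. *)
Lemma leads_antisym_even d N (a0 a1 a2 : R) p : ~~ odd N -> leads N a0 a1 a2 p ->
  exists x, leads N 0 (2 * a1 - N%:R * d * a0) x (p - mirror d p).
Proof.
move=> oN t; have := leadsB t (leads_comp d t).
rewrite -signr_odd (negbTE oN) expr0 !mul1r subrr => h.
by eexists; apply: leads_eq h _ _ erefl => //; ring.
Qed.

Lemma leads_antisym_odd d N (a0 a1 a2 : R) p : odd N -> leads N a0 a1 a2 p ->
  exists x, leads N (2 * a0) (N%:R * d * a0) x (p - mirror d p).
Proof.
move=> oN t; have := leadsB t (leads_comp d t).
rewrite -signr_odd oN expr1 => h.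
by eexists; apply: leads_eq h _ _ erefl; ring.
Qed.

(** This is x(2x+1) Fhat[f] when eta, theta and kappa belong to the gauge factor
    of the eigenfunction. *)
Definition numerator (eta theta kappa p f : {poly R}) : {poly R} :=
  eta * theta * (kappa * p - mirror 1 (kappa * p)) * (f - mirror 0 f)
  - (eta * p - mirror 0 (eta * p)) *
    (theta * kappa * f - mirror 1 (theta * kappa * f)).

Variables (eta theta kappa p f : {poly R}).
Variables (e t k m n : nat).
Variables (eta1 eta2 theta1 theta2 kappa1 kappa2 a a2 c c2 : R).
Hypotheses (Heta : leads e 1 eta1 eta2 eta).
Hypotheses (Htheta : leads t 1 theta1 theta2 theta).
Hypotheses (Hkappa : leads k 1 kappa1 kappa2 kappa) (Htk : (t + k = 2)%N).
Hypotheses (Hp : leads m 1 a a2 p) (Hf : leads n 1 c c2 f) (Hek : odd e = odd k).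

Let N := (e + m + n.+2)%N.
Let D := numerator eta theta kappa p f.

Lemma leads_cast M (b0 b1 b2 : R) q :
  M = N -> leads M b0 b1 b2 q -> leads N b0 b1 b2 q.
Proof. by move=> ->. Qed.

Lemma indices : (e + t + (k + m) + n = N)%N /\ (e + m + (t + k + n) = N)%N.
Proof. by rewrite /N; lia. Qed.

Lemma natr_tk : t%:R + k%:R = 2 :> R.
Proof. by rewrite -natrD Htk. Qed.

(** In the next four lemmas both products in the numerator have the nominal
    degree N, and their coefficients at N agree: they are 0 if n or e + m is
    even, and 4 otherwise.  The coefficient at N - 1 need not cancel, except
    when n and e + m are both even: then each product contains two
    antisymmetrizations of even degree and drops by two. *)
Lemma leads_numerator_odd_even : odd (e + m) -> ~~ odd n ->
  exists x, leads N 0 (2 * (n%:R + 2 - 2 * (theta1 + kappa1))) x D.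
Proof.
move=> oem on.
have okm : odd (k + m) by move: oem; rewrite !oddD Hek.
have on2 : ~~ odd (t + k + n) by rewrite Htk oddD (negbTE on).
have [i1 i2] := indices.
have [x1 t1] := leads_antisym_odd 1 okm (leadsM Hkappa Hp).
have [x2 t2] := leads_antisym_even 0 on Hf.
have [x3 t3] := leads_antisym_odd 0 oem (leadsM Heta Hp).
have [x4 t4] := leads_antisym_even 1 on2 (leadsM (leadsM Htheta Hkappa) Hf).
have t5 := leadsB
  (leads_cast i1 (leadsM (leadsM (leadsM Heta Htheta) t1) t2))
  (leads_cast i2 (leadsM t3 t4)).
eexists; apply: leads_eq t5 _ _ erefl; first by ring.
rewrite !natrD; have := natr_tk; lra.
Qed.

Lemma leads_numerator_odd_odd : odd (e + m) -> odd n ->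
  exists x, leads N 0 (2 * (2 * (theta1 + eta1) + k%:R + m%:R - n%:R - 2)) x D.
Proof.
move=> oem on.
have okm : odd (k + m) by move: oem; rewrite !oddD Hek.
have on2 : odd (t + k + n) by rewrite Htk oddD on.
have [i1 i2] := indices.
have [x1 t1] := leads_antisym_odd 1 okm (leadsM Hkappa Hp).
have [x2 t2] := leads_antisym_odd 0 on Hf.
have [x3 t3] := leads_antisym_odd 0 oem (leadsM Heta Hp).
have [x4 t4] := leads_antisym_odd 1 on2 (leadsM (leadsM Htheta Hkappa) Hf).
have t5 := leadsB
  (leads_cast i1 (leadsM (leadsM (leadsM Heta Htheta) t1) t2))
  (leads_cast i2 (leadsM t3 t4)).
eexists; apply: leads_eq t5 _ _ erefl; first by ring.
rewrite !natrD; have := natr_tk; lra.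
Qed.

Lemma leads_numerator_even_odd : ~~ odd (e + m) -> odd n ->
  exists x, leads N 0 (2 * (2 * kappa1 - k%:R - m%:R - 2 * eta1)) x D.
Proof.
move=> oem on.
have okm : ~~ odd (k + m) by move: oem; rewrite !oddD Hek.
have on2 : odd (t + k + n) by rewrite Htk oddD on.
have [i1 i2] := indices.
have [x1 t1] := leads_antisym_even 1 okm (leadsM Hkappa Hp).
have [x2 t2] := leads_antisym_odd 0 on Hf.
have [x3 t3] := leads_antisym_even 0 oem (leadsM Heta Hp).
have [x4 t4] := leads_antisym_odd 1 on2 (leadsM (leadsM Htheta Hkappa) Hf).
have t5 := leadsB
  (leads_cast i1 (leadsM (leadsM (leadsM Heta Htheta) t1) t2))
  (leads_cast i2 (leadsM t3 t4)).
eexists; apply: leads_eq t5 _ _ erefl; first by ring.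
rewrite !natrD; ring.
Qed.

Lemma leads_numerator_even_even : ~~ odd (e + m) -> ~~ odd n ->
  leads N 0 0 (2 * c * (2 * (kappa1 + a) - k%:R - m%:R)
    - 2 * (eta1 + a) * (2 * (c + theta1 + kappa1) - n%:R - 2)) D.
Proof.
move=> oem on.
have okm : ~~ odd (k + m) by move: oem; rewrite !oddD Hek.
have on2 : ~~ odd (t + k + n) by rewrite Htk oddD (negbTE on).
have [i1 i2] := indices.
have [x1 t1] := leads_antisym_even 1 okm (leadsM Hkappa Hp).
have [x2 t2] := leads_antisym_even 0 on Hf.
have [x3 t3] := leads_antisym_even 0 oem (leadsM Heta Hp).
have [x4 t4] := leads_antisym_even 1 on2 (leadsM (leadsM Htheta Hkappa) Hf).
have t5 := leadsB
  (leads_cast i1 (leadsM (leadsM (leadsM Heta Htheta) t1) t2))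
  (leads_cast i2 (leadsM t3 t4)).
apply: leads_eq t5 _ _ _; [by ring|by ring|].
rewrite !natrD natr_tk; ring.
Qed.

End Numerator.

(** * The eight sign patterns *)

(** The eight lists sigma_d correspond to the sign patterns in which the number
    of negated rho_j and the number of negated r_i have the same parity: u_j
    tells whether rho_j is negated, v_i whether r_i is. *)
Section Gauge.
Variables (R : realType).

Definition optFactor (b : bool) (d : R) : {poly R} := if b then lin 1 d else 1.

Definition sel (b : bool) (x : R) : R := if b then x else 0.

Definition flip (b : bool) (x : R) : R := if b then - x else x.

Lemma leads_optFactor (b : bool) (d : R) : leads b 1 (sel b d) 0 (optFactor b d).
Proof. by case: b; [exact: leads_linear | exact: leads_C]. Qed.

Variables (S : params R) (u1 u2 v1 v2 : bool).

Definition flipped : params R :=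
  Params (flip u1 (rho1 S)) (flip u2 (rho2 S)) (flip v1 (r1 S)) (flip v2 (r2 S)).

Definition etaP := optFactor u1 (- rho1 S) * optFactor u2 (- rho2 S).
Definition thetaP := optFactor v1 (r1 S + 1 / 2) * optFactor v2 (r2 S + 1 / 2).
Definition kappaP :=
  optFactor (~~ v1) (r1 S + 1 / 2) * optFactor (~~ v2) (r2 S + 1 / 2).

(** The combinations s and t that control the leading coefficients of the
    numerator. *)
Definition kappaSum :=
  sel (~~ v1) (r1 S) + sel (~~ v2) (r2 S) + sel u1 (rho1 S) + sel u2 (rho2 S).
Definition thetaSum :=
  sel v1 (r1 S) + sel v2 (r2 S) - sel u1 (rho1 S) - sel u2 (rho2 S).

Hypothesis par : u1 (+) u2 = v1 (+) v2.

Let cc := r1 S + r2 S - rho1 S - rho2 S.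

(** The sum on the left is the subleading coefficient of eta p.  For e + m even
    the quadratic polynomials of [subdiag] combine with the zeros of eta into a
    product of two linear factors. *)
Lemma subleading_factor m (a : R) : ~~ odd (u1 + u2 + m) ->
  (lambda flipped m - lambdaPred flipped m) * a = subdiag flipped m ->
  4 * (m%:R - (cc - 2 * thetaSum)) *
    (a + (sel u1 (- rho1 S) + sel u2 (- rho2 S))) =
  (m%:R - 2 * kappaSum) * (m%:R + 2 * thetaSum).
Proof.
rewrite !oddD !oddb par /lambda /lambdaPred /subdiag /cc /kappaSum /thetaSum.
rewrite /flipped /flip /sel /= => + H.
move: H; rewrite -?[m.+1%:R]natr1; case: (odd m) => /=;
  move: par; case: u1; case: u2; case: v1; case: v2 => //= _ H _; lra.
Qed.

Variables (m n : nat) (p f : {poly R}).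
Hypotheses (hp : is_BI flipped m p) (hf : is_BI S n f).
Hypotheses (hr : r1 S + r2 S \isn't a Num.int) (hc : cc \isn't a Num.int).
Hypothesis (hS : ~~ odd (u1 + u2 + m) -> 2 * kappaSum - m%:R != 0).
Hypothesis (hT : ~~ odd (u1 + u2 + m + n) -> 2 * thetaSum + m%:R - n%:R != 0).
Hypothesis (hc' : ~~ odd (u1 + u2 + m) -> cc - 2 * thetaSum - m%:R != 0).

Lemma double_int_neq (x : R) (k l : nat) :
  x \isn't a Num.int -> ~~ odd (k + l) ->
  2 * x + k%:R - l%:R != 0.
Proof.
move=> hx hkl; apply: (contraNneq _ hx) => e.
have e2 : (k + l)%:R = 2 * (k + l)./2%:R :> R.
  by rewrite -[in LHS](odd_double_half (k + l)) (negbTE hkl) add0n -mul2n natrM.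
have -> : x = (k + l)./2%:R - k%:R by move: e2; rewrite natrD; lra.
by rewrite rpredB ?natr_int.
Qed.

Lemma double_half_int_neq (x : R) (k l : nat) :
  x + 1 / 2 \isn't a Num.int -> odd (k + l) ->
  2 * x + k%:R - l%:R != 0.
Proof.
move=> hx hkl; apply: (contraNneq _ hx) => e.
have e2 : (k + l)%:R = 1 + 2 * (k + l)./2%:R :> R.
  by rewrite -[in LHS](odd_double_half (k + l)) hkl -mul2n natrD natrM.
have -> : x + 1 / 2 = (k + l)./2%:R + 1 - k%:R by move: e2; rewrite natrD; lra.
by rewrite rpredB ?rpredD ?natr_int ?rpred1.
Qed.

(** The linear factors in the hypotheses are those of the leading coefficient
    in the four parity cases and of its denominator in the last one. *)
Lemma size_numerator :
  size (numerator etaP thetaP kappaP p f) =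
  if ~~ odd (u1 + u2 + m) && ~~ odd n then (u1 + u2 + m + n).+1
  else (u1 + u2 + m + n).+2.
Proof.
have [a [a2 tp ea]] := BI_subleading hp.
have [c [c2 tf ec]] := BI_subleading hf.
have to := leads_optFactor.
have te := leadsM (to u1 (- rho1 S)) (to u2 (- rho2 S)).
have tt := leadsM (to v1 (r1 S + 1 / 2)) (to v2 (r2 S + 1 / 2)).
have tk := leadsM (to (~~ v1) (r1 S + 1 / 2)) (to (~~ v2) (r2 S + 1 / 2)).
rewrite -/etaP mulr1 in te.
rewrite -/thetaP mulr1 in tt.
rewrite -/kappaP mulr1 in tk.
have etk : (v1 + v2 + (~~ v1 + ~~ v2) = 2)%N by case: v1; case: v2.
have eek : odd (u1 + u2) = odd (~~ v1 + ~~ v2).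
  by rewrite !oddD !oddb par; case: v1; case: v2.
have hk : (~~ v1 + ~~ v2)%:R = 2 - (v1 + v2)%:R :> R.
  by case: v1; case: v2 => /=; lra.
(* The sums below are spelled as the product rule for the subleading
   coefficients of eta, theta and kappa produces them. *)
have hth : 2 * thetaSum =
    2 * ((1 * sel v2 (r2 S + 1 / 2) + sel v1 (r1 S + 1 / 2) * 1) +
      (1 * sel u2 (- rho2 S) + sel u1 (- rho1 S) * 1)) - (v1 + v2)%:R.
  by rewrite /thetaSum /sel; case: u1; case: u2; case: v1; case: v2 => /=; lra.
have hka : 2 * kappaSum =
    2 * ((1 * sel (~~ v2) (r2 S + 1 / 2) + sel (~~ v1) (r1 S + 1 / 2) * 1) -
      (1 * sel u2 (- rho2 S) + sel u1 (- rho1 S) * 1)) - (~~ v1 + ~~ v2)%:R.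
  by rewrite /kappaSum /sel; case: u1; case: u2; case: v1; case: v2 => /=; lra.
have hs12 : kappaSum + thetaSum = r1 S + r2 S.
  rewrite /kappaSum /thetaSum /sel.
  by case: u1; case: u2; case: v1; case: v2 => /=; lra.
have idx : (u1 + u2 + m + n.+2 = (u1 + u2 + m + n).+2)%N by rewrite !addnS.
case oem : (odd (u1 + u2 + m)); case on : (odd n) => /=.
- have [x t] := leads_numerator_odd_odd te tt tk etk tp tf eek oem on.
  rewrite idx in t; apply: (leads_sizeE1 t).
  have := hT; rewrite oddD oem on => /(_ isT); apply: contraNneq; lra.
- have [x t] := leads_numerator_odd_even te tt tk etk tp tf eek oem (negbT on).
  rewrite idx in t; apply: (leads_sizeE1 t).
  have := @double_int_neq _ 0 n hr (negbT on); apply: contraNneq; lra.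
- have [x t] := leads_numerator_even_odd te tt tk etk tp tf eek (negbT oem) on.
  rewrite idx in t; apply: (leads_sizeE1 t).
  have := hS; rewrite oem => /(_ isT); apply: contraNneq; lra.
have t := leads_numerator_even_even te tt tk etk tp tf eek
  (negbT oem) (negbT on).
rewrite idx in t; apply/succn_inj; apply: (leads_sizeE2 t).
have ha := subleading_factor (negbT oem) ea.
have nS : 2 * kappaSum - m%:R != 0 by apply: hS; rewrite oem.
have nT : 2 * thetaSum + m%:R - n%:R != 0 by apply: hT; rewrite oddD oem on.
have nc : cc - 2 * thetaSum - m%:R != 0 by apply: hc'; rewrite oem.
have h1 := @double_int_neq _ 0 n hr (negbT on).
have h3 : (n%:R - cc) * c = n%:R * (n%:R - 2 * (r1 S + r2 S)) / 4.
  by move: ec; rewrite /lambda /lambdaPred /subdiag on /cc => <-; field.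
set X := (X in X != 0).
have eX : X = 2 * c * (2 * kappaSum - m%:R) +
    2 * (a + (sel u1 (- rho1 S) + sel u2 (- rho2 S))) *
    (n%:R - 2 * (r1 S + r2 S)).
  have e12 : 2 * (r1 S + r2 S) = 2 * kappaSum + 2 * thetaSum.
    by rewrite -hs12 mulrDr.
  by rewrite /X e12 hka hth hk; ring.
set A := a + _ in ha eX; set C' := cc - 2 * thetaSum in ha nc.
have cc0 : cc != 0 by exact: notint_neq0.
(* Substituting the two subleading coefficients, the terms quadratic in n
   cancel and the whole bracket factors. *)
have E : X * (4 * (n%:R - cc) * (m%:R - C')) =
  2 * (2 * (r1 S + r2 S) + 0%:R - n%:R) * (m%:R - 2 * kappaSum) * cc *
  (2 * thetaSum + m%:R - n%:R).
  have -> : X * (4 * (n%:R - cc) * (m%:R - C')) =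
    8 * (2 * kappaSum - m%:R) * (m%:R - C') * ((n%:R - cc) * c) +
    2 * (n%:R - 2 * (r1 S + r2 S)) * (n%:R - cc) * (4 * (m%:R - C') * A).
    by rewrite eX; ring.
  by rewrite h3 ha /C'; field.
apply/eqP => X0.
move: E; rewrite X0 mul0r => /esym/eqP.
rewrite !mulf_eq0 (negbTE h1) (negbTE nT) (negbTE cc0) pnatr_eq0 !orbF /=.
by rewrite -oppr_eq0 opprB (negbTE nS).
Qed.

End Gauge.

(** * The operator Fhat as a polynomial operator *)

(** The points where some Gamma value attached to the parameter c is at an
    integer. *)
Definition resonant (R : realType) (c : R) : set R :=
  [set x | (c + x \is a Num.int) || (c - x \is a Num.int)]%classic.

Lemma countable_resonant (R : realType) (c : R) : countable (resonant c).
Proof.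
have cint : countable (range (fun z : int => z%:~R - c) `|`
    range (fun z : int => c - z%:~R))%classic.
  by apply: countable_setU; apply: (@sub_countable _ _ _ [set: int]);
    rewrite ?countableP ?card_image_le.
apply: sub_countable cint; apply: subset_card_le => x /= /orP [] /intrP [z e].
  by left; exists z => //; rewrite -e; ring.
by right; exists z => //; rewrite -e; ring.
Qed.

Lemma horner_numerator (R : realType) (e t k p f : {poly R}) x :
  (numerator e t k p f).[x] =
  e.[x] * t.[x] * (k.[x] * p.[x] - k.[- x - 1] * p.[- x - 1]) * (f.[x] - f.[- x])
  - (e.[x] * p.[x] - e.[- x] * p.[- x]) *
    (t.[x] * k.[x] * f.[x] - t.[- x - 1] * k.[- x - 1] * f.[- x - 1]).
Proof.
by rewrite /numerator !(hornerD, hornerN, hornerM, horner_mirror) subr0.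
Qed.

Section Factors.
Variable R : realType.

Definition gFactor (b : bool) (r x : R) : R := if b then gfun r x else 1.
Definition qFactor (b : bool) (rho x : R) : R :=
  if b then (qfun rho x)^-1 else 1.

Lemma horner_optFactor b (d x : R) : (optFactor b d).[x] = if b then x + d else 1.
Proof.
by case: b; rewrite /optFactor ?horner_lin ?mul1r // -[1]/(1%:P) hornerC.
Qed.

Lemma gFactor_neq0 b (r x : R) : ~ resonant (1 / 2 + r) x -> gFactor b r x != 0.
Proof.
case: b; rewrite /gFactor ?oner_neq0 //.
move=> /negP; rewrite negb_or => /andP [hp hm].
by rewrite /gfun mulf_neq0 // Gamma_neq0.
Qed.

Lemma qFactor_neq0 b (rho x : R) : ~ resonant rho x -> qFactor b rho x != 0.
Proof.
case: b; rewrite /qFactor ?oner_neq0 //.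
move=> /negP; rewrite negb_or => /andP [hp hm].
by rewrite invr_neq0 // /qfun mulf_neq0 // Gamma_neq0 // -addrA rpredDl ?rpred1.
Qed.

Lemma gFactorN b (r x : R) : gFactor b r (- x) = gFactor b r x.
Proof. by case: b; rewrite /gFactor // /gfun opprK mulrC. Qed.

Lemma qFactor_shift b (rho x : R) : qFactor b rho (- x - 1) = qFactor b rho x.
Proof.
case: b; rewrite /qFactor // /qfun [in RHS]mulrC.
have -> : rho - (- x - 1) = 1 + rho + x by ring.
by have -> : 1 + rho + (- x - 1) = rho - x by ring.
Qed.

(** For a factor that is present this is Gamma(z+1) = z Gamma(z), applied to both
    Gamma values of g_i; for an absent one it says that kappa carries the
    linear factor instead of theta. *)
Lemma gFactor_shift b (r x : R) : ~ resonant (1 / 2 + r) x ->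
  (x - r + 1 / 2) * gFactor b r (- x - 1) =
  - (gFactor b r x * (optFactor b (r + 1 / 2)).[x] *
     (optFactor (~~ b) (r + 1 / 2)).[- x - 1]).
Proof.
move=> /negP; rewrite negb_or => /andP [hp hm].
rewrite !horner_optFactor; case: b; rewrite /gFactor /=; last by field.
rewrite /gfun.
have -> : 1 / 2 + r - (- x - 1) = (1 / 2 + r + x) + 1 by ring.
have e : Gamma (1 / 2 + r - x) =
    (1 / 2 + r - x - 1) * Gamma (1 / 2 + r + (- x - 1)).
  rewrite addrA -Gamma_succ ?subrK //.
  by rewrite rpredBr ?rpred1.
by rewrite Gamma_succ // e; field.
Qed.

Lemma qFactorN b (rho x : R) : ~ resonant rho x ->
  (optFactor b (- rho)).[x] * qFactor b rho (- x) =
  qFactor b rho x * (optFactor b (- rho)).[- x].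
Proof.
move=> h; move: (h) => /negP; rewrite negb_or => /andP [hp hm].
rewrite !horner_optFactor; case: b; rewrite /qFactor /=; last by rewrite !mulr1.
rewrite /qfun opprK.
have -> : 1 + rho - x = rho - x + 1 by ring.
have -> : 1 + rho + x = rho + x + 1 by ring.
rewrite !Gamma_succ //.
have [g1 g2] := (Gamma_neq0 hp, Gamma_neq0 hm).
have [n1 n2] := (notint_neq0 hp, notint_neq0 hm).
by field; rewrite n1 n2 g1 g2.
Qed.

Variables (S : params R) (u1 u2 v1 v2 : bool).

Definition xiFactors (x : R) : R :=
  gFactor v1 (r1 S) x * gFactor v2 (r2 S) x *
  (qFactor u1 (rho1 S) x * qFactor u2 (rho2 S) x).

Let eP := etaP S u1 u2.
Let tP := thetaP S v1 v2.
Let kP := kappaP S v1 v2.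

(** The parameters 0 and 1/2 take care of the poles at x = 0 and x = -1/2. *)
Definition exceptional : set R :=
  (resonant (1 / 2 + r1 S) `|` resonant (1 / 2 + r2 S) `|`
   (resonant (rho1 S) `|` resonant (rho2 S)) `|`
   (resonant 0 `|` resonant (1 / 2)))%classic.

Lemma countable_exceptional : countable exceptional.
Proof. by do !apply: countable_setU; exact: countable_resonant. Qed.

(** After multiplication by eta / xi the combinations chi and (2x+1) chit become
    the two antisymmetrizations of eta p and of kappa p, because the quotients
    of xi at x, -x and -x-1 are rational. *)
Lemma Fhat_numerator (d m : nat) (f : {poly R}) x :
  (forall y, xi S d y = xiFactors y) -> (forall y, eta S d y = eP.[y]) ->
  ~ exceptional x ->
  Fhat S d m (horner f) x * (x * (2 * x + 1)) =
  (numerator eP tP kP (BI (sigma S d) m) f).[x].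
Proof.
move=> hxi heta hx.
have hr1 : ~ resonant (1 / 2 + r1 S) x by move=> h; apply: hx; do 3 left.
have hr2 : ~ resonant (1 / 2 + r2 S) x by move=> h; apply: hx; do 2 left; right.
have hq1 : ~ resonant (rho1 S) x by move=> h; apply: hx; left; right; left.
have hq2 : ~ resonant (rho2 S) x by move=> h; apply: hx; left; right; right.
have x0 : x != 0.
  by apply/eqP => e; apply: hx; right; left; rewrite /resonant /= e addr0 rpred0.
have x1 : 2 * x + 1 != 0.
  apply/eqP => e; apply: hx; right; right; rewrite /resonant /=.
  have -> : 1 / 2 + x = 0 by lra.
  by rewrite rpred0.
pose X := xiFactors x.
have X0 : X != 0 by rewrite /X /xiFactors !mulf_neq0 ?gFactor_neq0 ?qFactor_neq0.
have hN : eP.[x] * xiFactors (- x) = X * eP.[- x].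
  rewrite /X /xiFactors !gFactorN /eP /etaP !hornerM.
  transitivity (gFactor v1 (r1 S) x * gFactor v2 (r2 S) x *
    (((optFactor u1 (- rho1 S)).[x] * qFactor u1 (rho1 S) (- x)) *
     ((optFactor u2 (- rho2 S)).[x] * qFactor u2 (rho2 S) (- x))));
    first by ring.
  by rewrite !qFactorN //; ring.
have hT : (x - r1 S + 1 / 2) * (x - r2 S + 1 / 2) * xiFactors (- x - 1) =
    X * tP.[x] * kP.[- x - 1].
  rewrite /X /xiFactors !qFactor_shift /tP /kP /thetaP /kappaP !hornerM.
  transitivity (((x - r1 S + 1 / 2) * gFactor v1 (r1 S) (- x - 1)) *
    ((x - r2 S + 1 / 2) * gFactor v2 (r2 S) (- x - 1)) *
    (qFactor u1 (rho1 S) x * qFactor u2 (rho2 S) x)); first by ring.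
  by rewrite !gFactor_shift //; ring.
have hb y : tP.[y] * kP.[y] = (y + r1 S + 1 / 2) * (y + r2 S + 1 / 2).
  rewrite /tP /kP /thetaP /kappaP !hornerM !horner_optFactor.
  by case: v1; case: v2 => /=; ring.
set p := BI (sigma S d) m.
have hchi : chi S d m x * eP.[x] = X * (eP.[x] * p.[x] - eP.[- x] * p.[- x]).
  rewrite /chi /phi !hxi -/p -/X mulrBl.
  have -> : xiFactors (- x) * p.[- x] * eP.[x] =
    (eP.[x] * xiFactors (- x)) * p.[- x] by ring.
  by rewrite hN; ring.
have hbetaN : (2 * x + 1) * beta S (- x - 1) = - (tP.[x] * kP.[x]).
  have x2 : 2 * (- x - 1) + 1 != 0.
    by rewrite (_ : _ + 1 = - (2 * x + 1)) ?oppr_eq0 //; ring.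
  rewrite hb /beta.
  by field.
have hbeta : (2 * x + 1) * beta S x = (x - r1 S + 1 / 2) * (x - r2 S + 1 / 2).
  by rewrite /beta; field.
have hchit : (2 * x + 1) * chit S d m x =
    - (X * tP.[x] * (kP.[x] * p.[x] - kP.[- x - 1] * p.[- x - 1])).
  rewrite /chit /phi !hxi -/p -/X.
  transitivity (((2 * x + 1) * beta S (- x - 1)) * (X * p.[x]) +
     ((2 * x + 1) * beta S x) * xiFactors (- x - 1) * p.[- x - 1]);
    first by ring.
  by rewrite hbetaN hbeta hT; ring.
rewrite /Fhat /opT /opR hxi heta -/X horner_numerator.
have -> : - (x + 1) = - x - 1 by ring.
have -> : - (- x - 1) - 1 = x by ring.
have -> : (chit S d m x * (eP.[x] / (x * X)) * (f.[- x] - f.[x]) +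
  chi S d m x * (eP.[x] / (x * X)) *
    (beta S x * f.[- x - 1] + beta S (- x - 1) * f.[x])) *
    (x * (2 * x + 1)) =
  ((2 * x + 1) * chit S d m x) * eP.[x] / X * (f.[- x] - f.[x]) +
  (chi S d m x * eP.[x]) / X *
    (((2 * x + 1) * beta S x) * f.[- x - 1] +
     ((2 * x + 1) * beta S (- x - 1)) * f.[x]).
  by field; rewrite X0 x0.
rewrite hchit hchi hbeta hbetaN.
have -> : tP.[- x - 1] * kP.[- x - 1] = (x - r1 S + 1 / 2) * (x - r2 S + 1 / 2).
  by rewrite hb; field.
by field.
Qed.

End Factors.

(** * The degrees *)
Lemma divide_X_2X1 (R : realType) (D : {poly R}) k : size D = k.+3 ->
  D.[0] = 0 -> D.[- (1 / 2)] = 0 ->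
  exists2 P : {poly R}, D = P * ('X * lin 2 1) & size P = k.+1.
Proof.
move=> sD /eqP D0 D1.
have [Q eQ] := factor_theorem D 0 D0.
have : root Q (- (1 / 2)).
  move: D1; rewrite eQ hornerM hornerXsubC => /eqP.
  rewrite mulf_eq0 rootE orbC subr0 oppr_eq0 mul1r invr_eq0 pnatr_eq0 /=.
  by [].
move=> /factor_theorem [P eP].
have eD : D = (2^-1 *: P) * ('X * lin 2 1).
  rewrite eQ eP polyC0 subr0 /lin polyCN opprK -!mul_polyC.
  have -> : (2^-1)%:P * P * ('X * (2%:P * 'X + 1%:P)) =
    P * 'X * ((2^-1)%:P * 2%:P * 'X + (2^-1)%:P) :> {poly R} by ring.
  by rewrite -polyCM mulVf ?pnatr_eq0 // mul1r mul1r; ring.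
exists (2^-1 *: P) => //.
have P0 : 2^-1 *: P != 0.
  by apply: contra_eqN (sD) => /eqP e; rewrite eD e mul0r size_poly0.
have sl : size (lin 2 1 : {poly R}) = 2%N.
  rewrite /lin -mul_polyC size_MXaddC polyC_eq0 pnatr_eq0 /=.
  by rewrite size_polyC pnatr_eq0.
have l0 : lin 2 1 != 0 :> {poly R} by rewrite -size_poly_eq0 sl.
move: sD; rewrite eD size_mul ?mulf_neq0 ?polyX_eq0 //.
by rewrite (size_mul (negbT (polyX_eq0 R)) l0) size_polyX sl addn3 => /= -[].
Qed.

(** The numerator vanishes at the fixed points 0 and -1/2 of the two
    reflections; its quotient by x(2x+1) agrees with Fhat[f] off a countable
    set and is the only polynomial to do so. *)
Lemma size_B1 (R : realType) (S : params R) (u1 u2 v1 v2 : bool)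
    (d m n k : nat) :
  (forall y, xi S d y = xiFactors S u1 u2 v1 v2 y) ->
  (forall y, eta S d y = (etaP S u1 u2).[y]) ->
  size (numerator (etaP S u1 u2) (thetaP S v1 v2) (kappaP S v1 v2)
    (BI (sigma S d) m) (BI S n)) = k.+3 ->
  has_degree (B1 S d m n) k.
Proof.
move=> hxi heta; set D := numerator _ _ _ _ _ => sD.
have D0 : D.[0] = 0.
  by rewrite horner_numerator oppr0 !subrr; ring.
have D1 : D.[- (1 / 2)] = 0.
  rewrite horner_numerator; have -> : - - (1 / 2) - 1 = - (1 / 2) :> R by field.
  by rewrite !subrr; ring.
have [P eP sP] := divide_X_2X1 sD D0 D1.
have hP : countable [set x | Fhat S d m (horner (BI S n)) x <> P.[x]]%classic.
  apply: sub_countable (countable_exceptional S).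
  apply: subset_card_le => x /= hx.
  apply: contrapT => nx; apply: hx.
  have := Fhat_numerator m (BI S n) hxi heta nx.
  rewrite -/D eP !hornerM hornerX horner_lin.
  apply: mulIf; rewrite mulf_neq0 //.
    by apply/eqP => e; apply: nx; right; left; rewrite /resonant /= e addr0 rpred0.
  apply/eqP => e; apply: nx; right; right; rewrite /resonant /=.
  have -> : 1 / 2 + x = 0 by lra.
  by rewrite rpred0.
rewrite /has_degree /B1 (@xget_unique _ _ _ P) // => Q /= hQ.
apply: (poly_eq_off_countable (countable_setU hP hQ)) => x /= nx.
have [e1 e2] : Fhat S d m (horner (BI S n)) x = P.[x] /\
    Fhat S d m (horner (BI S n)) x = Q.[x].
  by split; apply: contrapT => h; apply: nx; [left|right].
by rewrite -e1 -e2.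
Qed.

Lemma size_arith (q n : nat) : (0 < q)%N ->
  ((if odd q then q - 1 + n else q - 2 + (uphalf n).*2).+3 =
   if ~~ odd q && ~~ odd n then (q + n).+1 else (q + n).+2)%N.
Proof.
move=> q0; have := odd_double_half n; rewrite uphalf_half.
case oq : (odd q) => /=; first by lia.
have q1 : (1 < q)%N by case: q q0 oq => [|[]].
by case: (odd n) => /=; lia.
Qed.

(** The sums s and t and the number c' = c - 2t are arguments so that
    each of the eight cases can state its conditions in simplified form. *)
Lemma degree_B1 (R : realType) (S : params R) (u1 u2 v1 v2 : bool)
    (d m n e : nat) (sk st c' : R) :
  (u1 + u2)%N = e -> u1 (+) u2 = v1 (+) v2 ->
  (forall y, xi S d y = xiFactors S u1 u2 v1 v2 y) ->
  (forall y, eta S d y = (etaP S u1 u2).[y]) ->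
  sigma S d = flipped S u1 u2 v1 v2 ->
  (exists p, is_BI (sigma S d) m p) ->
  r1 S + r2 S \isn't a Num.int ->
  r1 S + r2 S - rho1 S - rho2 S \isn't a Num.int ->
  kappaSum S u1 u2 v1 v2 = sk -> thetaSum S u1 u2 v1 v2 = st ->
  r1 S + r2 S - rho1 S - rho2 S - 2 * st = c' ->
  (odd m = odd e -> 2 * sk + 0 - m%:R != 0) ->
  (odd (m + n) = odd e -> 2 * st + m%:R - n%:R != 0) ->
  (odd m = odd e -> c' - m%:R != 0) ->
  (0 < e + m)%N ->
  has_degree (B1 S d m n)
    (if odd m == odd e then (e + m - 2 + (uphalf n).*2)%N
     else (e + m - 1 + n)%N).
Proof.
move=> <- par hxi heta hsig /xgetPex hp hr hc <- <- <- h1 h2 h3 pos.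
have hf : is_BI S n (BI S n).
  by have /xgetPex := BI_exists (lambda_inj hc (n := n)); exact.
have hp2 : is_BI (flipped S u1 u2 v1 v2) m (BI (sigma S d) m).
  by rewrite -{1}hsig; exact: hp.
have ode : odd (u1 + u2 + m) = (odd m != odd (u1 + u2)).
  by rewrite oddD; case: (odd m); case: (odd _).
apply: (size_B1 hxi heta).
rewrite (size_numerator par hp2 hf hr hc).
- by rewrite -(size_arith n pos) ode if_neg; case: ifP.
- by rewrite ode negbK => /eqP /h1; rewrite addr0.
- move=> o; apply: h2; move: o; rewrite -addnA oddD.
  by case: (odd (m + n)); case: (odd _).
- by rewrite ode negbK => /eqP /h3.
Qed.

Theorem proposition4p3 (R : realType) (rho1 rho2 r1 r2 : R)
  (hr : r1 + r2 \isn't a Num.int)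
  (hrho : rho1 + rho2 \isn't a Num.int)
  (hsum : r1 + r2 + rho1 + rho2 \isn't a Num.int)
  (hdiff : r1 + r2 - rho1 - rho2 \isn't a Num.int)
  (hhalf1 : (r1 - r2 - rho1 + rho2 + 1) / 2 \isn't a Num.int)
  (hhalf2 : (r1 - r2 + rho1 - rho2 + 1) / 2 \isn't a Num.int)
  (hmix : forall ri rhoj : R, ri \in [:: r1; r2] -> rhoj \in [:: rho1; rho2] ->
     ri - rhoj + 1 / 2 \isn't a Num.int /\ ri + rhoj + 1 / 2 \isn't a Num.int)
  (d m : nat) (hd : (1 <= d <= 8)%N)
  (hdm : (d, m) <> (1%N, 0%N) /\ (d, m) <> (4%N, 0%N))
  (hphi : exists! p : {poly R}, is_BI (sigma (Params rho1 rho2 r1 r2) d) m p) :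
  forall n : nat, ~ (d = 1%N /\ n = m) ->
  let Bn := B1 (Params rho1 rho2 r1 r2) d m n in
  (odd m ->
    [/\ d = 1%N -> has_degree Bn (m - 1 + n),
        d = 4%N -> has_degree Bn (m - 1 + n),
        d \in [:: 2; 3]%N -> has_degree Bn (m + 1 + n) &
        d \in [:: 5; 6; 7; 8]%N -> has_degree Bn (m - 1 + (uphalf n).*2)]) /\
  (~~ odd m ->
    [/\ d = 1%N -> has_degree Bn (m - 2 + (uphalf n).*2),
        d = 4%N -> has_degree Bn (m - 2 + (uphalf n).*2),
        d \in [:: 2; 3]%N -> has_degree Bn (m + (uphalf n).*2) &
        d \in [:: 5; 6; 7; 8]%N -> has_degree Bn (m + n)]).
Proof.
move=> n hn Bn; rewrite {}/Bn.
have hex : exists p, is_BI (sigma (Params rho1 rho2 r1 r2) d) m p.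
  by case: hphi => p [hp _]; exists p.
have mix (ri rhoj : R) : ri \in [:: r1; r2] -> rhoj \in [:: rho1; rho2] ->
  (forall k l : nat, odd (k + l) -> 2 * (ri - rhoj) + k%:R - l%:R != 0) /\
  (forall k l : nat, odd (k + l) -> 2 * (ri + rhoj) + k%:R - l%:R != 0).
  move=> h1 h2; have [a b] := hmix _ _ h1 h2.
  by split=> k l; exact: double_half_int_neq.
have ir1 : r1 \in [:: r1; r2] by rewrite !inE eqxx.
have ir2 : r2 \in [:: r1; r2] by rewrite !inE eqxx orbT.
have iq1 : rho1 \in [:: rho1; rho2] by rewrite !inE eqxx.
have iq2 : rho2 \in [:: rho1; rho2] by rewrite !inE eqxx orbT.
have sub_nat (x : R) (k : nat) : x \isn't a Num.int -> x - k%:R != 0.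
  by move=> hx; apply: notint_neq0; rewrite rpredBr ?natr_int.
(* For d >= 5 the denominator m - c + 2t involves an odd m and a number c - 2t
   that is known only not to be an odd integer. *)
have half (x y : R) : x / 2 \isn't a Num.int -> y = 1 - x \/ y = x - 1 ->
    odd m = true -> y - m%:R != 0.
  move=> hx hy om; have -> : y - m%:R = 2 * (y / 2) + 0%:R - m%:R by field.
  apply: double_half_int_neq => //; case: hy => ->.
    by rewrite (_ : (1 - x) / 2 + 1 / 2 = 1 - x / 2) ?rpredBl ?rpred1 //; field.
  by rewrite (_ : (x - 1) / 2 + 1 / 2 = x / 2) //; field.
pose P := Params rho1 rho2 r1 r2.
have D1 : d = 1%N -> has_degree (B1 P d m n)
    (if odd m == false then (m - 2 + (uphalf n).*2)%N else (m - 1 + n)%N).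
  move=> d1; rewrite d1 in hex hn hdm *.
  have m0 : (0 < m)%N.
    by rewrite lt0n; apply/eqP => e; apply: (proj1 hdm); rewrite e.
  apply: (@degree_B1 _ P false false false false _ m n 0
    (r1 + r2) 0 (r1 + r2 - rho1 - rho2)) => //.
  - by move=> y; rewrite /xiFactors /= !mulr1.
  - by move=> y; rewrite /etaP hornerM !horner_optFactor /= mulr1.
  - by rewrite /kappaSum /=; ring.
  - by rewrite /thetaSum /=; ring.
  - by rewrite /=; ring.
  - by move=> om; apply: (@double_int_neq _ _ 0 m hr); rewrite add0n om.
  - move=> _; rewrite mulr0 add0r subr_eq0 eqr_nat; apply/eqP => e.
    by apply: hn.
  - by move=> _; exact: sub_nat.
have D4 : d = 4%N -> has_degree (B1 P d m n)
    (if odd m == false then (m - 2 + (uphalf n).*2)%N else (m - 1 + n)%N).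
  move=> d4; rewrite d4 in hex hn hdm *.
  have m0 : (0 < m)%N.
    by rewrite lt0n; apply/eqP => e; apply: (proj2 hdm); rewrite e.
  apply: (@degree_B1 _ P false false true true _ m n 0
    0 (r1 + r2) (- (r1 + r2 + rho1 + rho2))) => //.
  - by move=> y; rewrite /xiFactors /= !mulr1.
  - by move=> y; rewrite /etaP hornerM !horner_optFactor /= mulr1.
  - by rewrite /kappaSum /=; ring.
  - by rewrite /thetaSum /=; ring.
  - by rewrite /=; ring.
  - by move=> _; rewrite mulr0 !add0r oppr_eq0 pnatr_eq0 -lt0n.
  - by move=> om; apply: double_int_neq => //; rewrite om.
  - by move=> _; apply: sub_nat; rewrite rpredN.
have D2 : d = 2%N -> has_degree (B1 P d m n)
    (if odd m == false then (2 + m - 2 + (uphalf n).*2)%N else (2 + m - 1 + n)%N).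
  move=> d2; rewrite d2 in hex hn hdm *.
  apply: (@degree_B1 _ P true true true true _ m n 2
    (rho1 + rho2) (r1 + r2 - rho1 - rho2) (- (r1 + r2 - rho1 - rho2))) => //.
  - by move=> y; rewrite /xiFactors /= invfM.
  - by move=> y; rewrite /etaP hornerM !horner_optFactor /=.
  - by rewrite /kappaSum /=; ring.
  - by rewrite /=; ring.
  - by move=> om; apply: (@double_int_neq _ _ 0 m) => //; rewrite add0n om.
  - by move=> om; apply: double_int_neq => //; rewrite om.
  - by move=> _; apply: sub_nat; rewrite rpredN.
have D3 : d = 3%N -> has_degree (B1 P d m n)
    (if odd m == false then (2 + m - 2 + (uphalf n).*2)%N else (2 + m - 1 + n)%N).
  move=> d3; rewrite d3 in hex hn hdm *.
  apply: (@degree_B1 _ P true true false false _ m n 2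
    (r1 + r2 + rho1 + rho2) (- (rho1 + rho2)) (r1 + r2 + rho1 + rho2)) => //.
  - by move=> y; rewrite /xiFactors /= invfM !mul1r.
  - by move=> y; rewrite /etaP hornerM !horner_optFactor /=.
  - by rewrite /thetaSum /=; ring.
  - by rewrite /=; ring.
  - by move=> om; apply: (@double_int_neq _ _ 0 m) => //; rewrite add0n om.
  - by move=> om; apply: double_int_neq; rewrite ?rpredN // om.
  - by move=> _; apply: sub_nat.
have D5 : d = 5%N -> has_degree (B1 P d m n)
    (if odd m == true then (1 + m - 2 + (uphalf n).*2)%N else (1 + m - 1 + n)%N).
  move=> d5; rewrite d5 in hex hn hdm *.
  have [mm _] := mix _ _ ir1 iq1; have [_ mp] := mix _ _ ir2 iq1.
  apply: (@degree_B1 _ P true false true false _ m n 1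
    (r2 + rho1) (r1 - rho1) (- r1 + r2 + rho1 - rho2)) => //.
  - by move=> y; rewrite /xiFactors /= !mulr1.
  - by move=> y; rewrite /etaP hornerM !horner_optFactor /= mulr1.
  - by rewrite /kappaSum /=; ring.
  - by rewrite /thetaSum /=; ring.
  - by rewrite /=; ring.
  - by move=> om; apply: (mp 0%N); rewrite add0n om.
  - by move=> om; apply: mm.
  - by apply: (half _ _ hhalf1); left; ring.
have D6 : d = 6%N -> has_degree (B1 P d m n)
    (if odd m == true then (1 + m - 2 + (uphalf n).*2)%N else (1 + m - 1 + n)%N).
  move=> d6; rewrite d6 in hex hn hdm *.
  have [mm _] := mix _ _ ir2 iq2; have [_ mp] := mix _ _ ir1 iq2.
  apply: (@degree_B1 _ P false true false true _ m n 1
    (r1 + rho2) (r2 - rho2) (r1 - r2 - rho1 + rho2)) => //.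
  - by move=> y; rewrite /xiFactors /= !mul1r.
  - by move=> y; rewrite /etaP hornerM !horner_optFactor /= mul1r.
  - by rewrite /kappaSum /=; ring.
  - by rewrite /thetaSum /=; ring.
  - by rewrite /=; ring.
  - by move=> om; apply: (mp 0%N); rewrite add0n om.
  - by move=> om; apply: mm.
  - by apply: (half _ _ hhalf1); right; ring.
have D7 : d = 7%N -> has_degree (B1 P d m n)
    (if odd m == true then (1 + m - 2 + (uphalf n).*2)%N else (1 + m - 1 + n)%N).
  move=> d7; rewrite d7 in hex hn hdm *.
  have [mm _] := mix _ _ ir1 iq2; have [_ mp] := mix _ _ ir2 iq2.
  apply: (@degree_B1 _ P false true true false _ m n 1
    (r2 + rho2) (r1 - rho2) (- r1 + r2 - rho1 + rho2)) => //.
  - by move=> y; rewrite /xiFactors /= !mul1r mulr1.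
  - by move=> y; rewrite /etaP hornerM !horner_optFactor /= mul1r.
  - by rewrite /kappaSum /=; ring.
  - by rewrite /thetaSum /=; ring.
  - by rewrite /=; ring.
  - by move=> om; apply: (mp 0%N); rewrite add0n om.
  - by move=> om; apply: mm.
  - by apply: (half _ _ hhalf2); left; ring.
have D8 : d = 8%N -> has_degree (B1 P d m n)
    (if odd m == true then (1 + m - 2 + (uphalf n).*2)%N else (1 + m - 1 + n)%N).
  move=> d8; rewrite d8 in hex hn hdm *.
  have [mm _] := mix _ _ ir2 iq1; have [_ mp] := mix _ _ ir1 iq1.
  apply: (@degree_B1 _ P true false false true _ m n 1
    (r1 + rho1) (r2 - rho1) (r1 - r2 + rho1 - rho2)) => //.
  - by move=> y; rewrite /xiFactors /= mul1r mulr1.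
  - by move=> y; rewrite /etaP hornerM !horner_optFactor /= mulr1.
  - by rewrite /kappaSum /=; ring.
  - by rewrite /thetaSum /=; ring.
  - by rewrite /=; ring.
  - by move=> om; apply: (mp 0%N); rewrite add0n om.
  - by move=> om; apply: mm.
  - by apply: (half _ _ hhalf2); right; ring.
rewrite -/P; split=> om; move: D1 D2 D3 D4 D5 D6 D7 D8;
  rewrite ?om ?(negbTE om) /= => D1 D2 D3 D4 D5 D6 D7 D8; split => //.
- by rewrite !inE => /orP [/eqP /D2|/eqP /D3]; rewrite add2n subn1 addn1.
- rewrite !inE => /or4P [] /eqP;
    [move/D5|move/D6|move/D7|move/D8]; by rewrite add1n subSS.
- by rewrite !inE => /orP [/eqP /D2|/eqP /D3]; rewrite addKn.
- rewrite !inE => /or4P [] /eqP;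
    [move/D5|move/D6|move/D7|move/D8]; by rewrite addKn.
Qed.
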